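(* Let $K$ be a field, let $m,n\ge 1$, and let $S=K[x_1,\dots,x_m,t_1,\dots,t_n]$ be the polynomial ring bigraded by $\deg x_i=(1,0)$ for $i=1,\dots,m$ and $\deg t_i=(0,1)$ for $i=1,\dots,n$. Let $I$ be an ideal of $S$ generated by a regular sequence of elements of $S$ all of bidegree $(2,1)$, and let $R=S/I$. Let $\Delta=(1,1)\mathbf{Z}\subset\mathbf{Z}^2$. Then: (1) $R_\Delta$ is Koszul. (2) For every $(a,b)\in\mathbf{Z}^2$ the module $R(-a,-b)_\Delta$ has a linear $R_\Delta$-resolution, i.e. $\operatorname{reg}_{R_\Delta} R(-a,-b)_\Delta=\max(a,b)$.
   Context: For a bigraded $R$-module $M=\bigoplus_{(i,j)\in\mathbf{Z}^2}M_{(i,j)}$, set $M_\Delta=\bigoplus_{i\in\mathbf{Z}}M_{(i,i)}$, graded by $i$. Then $R_\Delta$ is a standard graded $K$-algebra (generated over $K$ by $R_{(1,1)}$ in degree $1$) and $M_\Delta$ is a graded $R_\Delta$-module. $R(-a,-b)$ is the shifted module with $R(-a,-b)_{(i,j)}=R_{(i-a,j-b)}$. For a standard graded $K$-algebra $A$ (i.e. $A=\bigoplus_{i\ge0}A_i$ commutative, $A_0=K$, $\dim_KA_1<\infty$, generated by $A_1$) and a non-zero graded $A$-module $M$, the relative Castelnuovo–Mumford regularity is $\operatorname{reg}_A(M)=\sup\{j-i : \operatorname{Tor}_i^A(M,K)_j\ne0\}\in\mathbf{Z}\cup\{+\infty\}$, where $K=A/A_+$. $M$ has a linear $A$-resolution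 if $M$ is generated in a single degree $d$ and $\operatorname{reg}_A(M)=d$. $A$ is Koszul if $K$ has a linear $A$-resolution, i.e. $\operatorname{reg}_A(K)=0$. *)

(* Defs.v *)
From HB Require Import structures.
From mathcomp Require Import all_boot all_order all_algebra.
From mathcomp Require Import generic_quotient ring_quotient.
(* mpoly has to be imported before constructive_ereal: their notations clash
   in the other order. *)
From mathcomp Require Import mpoly.
From mathcomp Require Import boolp classical_sets constructive_ereal.

Set Implicit Arguments.
Unset Strict Implicit.
Unset Printing Implicit Defensive.

Import Order.TTheory GRing.Theory Num.Theory.
Local Open Scope ring_scope.
Local Open Scope quotient_scope.

(* The finite sums of elements of [P].  It is the subgroup generated by [P]
   when [P] is stable under opposite, which is the case in every use below. *)
Definition span (V : nmodType) (P : V -> Prop) (x : V) : Prop :=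
  exists2 s : seq V, {in s, forall v, P v} & x = \sum_(v <- s) v.

Section SpanTheory.
Variable V : zmodType.
Implicit Types P Q : V -> Prop.

Lemma span0 P : span P 0.
Proof. by exists [::] => //; rewrite big_nil. Qed.

Lemma span_mem P x : P x -> span P x.
Proof.
move=> Px; exists [:: x]; last by rewrite big_seq1.
by move=> y; rewrite inE => /eqP->.
Qed.

Lemma spanD P x y : span P x -> span P y -> span P (x + y).
Proof.
move=> [s Ps ->] [t Pt ->]; exists (s ++ t); last by rewrite big_cat.
by move=> v; rewrite mem_cat => /orP[/Ps|/Pt].
Qed.

Lemma span_ind P Q :
  Q 0 -> (forall x y, Q x -> Q y -> Q (x + y)) -> (forall x, P x -> Q x) ->
  forall x, span P x -> Q x.
Proof.
move=> Q0 QD PQ _ [s Ps ->]; elim: s Ps => [|v s IHs] Ps.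
  by rewrite big_nil.
rewrite big_cons; apply: QD; first by apply/PQ/Ps; rewrite inE eqxx.
by apply: IHs => w ws; apply: Ps; rewrite inE ws orbT.
Qed.

Lemma spanB P x y : (forall v, P v -> P (- v)) ->
  span P x -> span P y -> span P (x - y).
Proof.
move=> PN Px Py; apply: spanD Px _.
elim/span_ind: y / Py => [|v w Pv Pw|v /PN/span_mem//].
  by rewrite oppr0; apply: span0.
by rewrite opprD; apply: spanD.
Qed.

End SpanTheory.

Lemma span_map (V W : zmodType) (f : {additive V -> W}) (P : V -> Prop)
    (Q : W -> Prop) :
  (forall x, P x -> span Q (f x)) -> forall x, span P x -> span Q (f x).
Proof.
move=> PQ x; elim/span_ind: x / => [|x y Qx Qy|//]; first by rewrite raddf0; apply: span0.
by rewrite raddfD; apply: spanD.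
Qed.

(* [is_grading H] says that [V] is the direct sum of the subgroups [H g]. *)
Record is_grading (G : zmodType) (V : zmodType) (H : G -> V -> Prop) : Prop :=
  IsGrading {
    grading0 : forall g, H g 0;
    gradingB : forall g x y, H g x -> H g y -> H g (x - y);
    grading_span : forall x, span (fun v => exists g, H g v) x;
    grading_indep : forall (s : seq G) (f : G -> V),
      uniq s -> {in s, forall g, H g (f g)} ->
      \sum_(g <- s) f g = 0 -> {in s, forall g, f g = 0} }.

Record graded_ring (G : zmodType) := GradedRing {
  gr_sort :> comPzRingType;
  gr_homog : G -> gr_sort -> Prop;
  gr_grading : is_grading gr_homog;
  gr_homog1 : gr_homog 0 1;
  gr_homogM : forall g h x y,
    gr_homog g x -> gr_homog h y -> gr_homog (g + h) (x * y) }.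

Record graded_module (G : zmodType) (A : graded_ring G) := GradedModule {
  gm_sort :> lmodType A;
  gm_homog : G -> gm_sort -> Prop;
  gm_grading : is_grading gm_homog;
  gm_homogZ : forall g h (a : A) x,
    gr_homog g a -> gm_homog h x -> gm_homog (g + h) (a *: x) }.

Record graded_submod (G : zmodType) (A : graded_ring G) (M : graded_module A) :=
  GradedSubmod {
    gs_mem :> M -> Prop;
    gs_mem0 : gs_mem 0;
    gs_memB : forall x y, gs_mem x -> gs_mem y -> gs_mem (x - y);
    gs_memZ : forall (a : A) x, gs_mem x -> gs_mem (a *: x);
    gs_memH : forall x, gs_mem x ->
      span (fun v => gs_mem v /\ exists g, gm_homog g v) x }.

Section GradingTheory.
Variables (G V : zmodType) (H : G -> V -> Prop).
Hypothesis HG : is_grading H.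

Lemma gradingN g x : H g x -> H g (- x).
Proof. by rewrite -sub0r; apply/(gradingB HG)/(grading0 HG). Qed.

Lemma gradingD g x y : H g x -> H g y -> H g (x + y).
Proof. by move=> Hx Hy; rewrite -[y]opprK; apply/(gradingB HG)/gradingN. Qed.

Lemma span_homogP (P : V -> Prop) : P 0 ->
  (forall x y, P x -> P y -> P (x + y)) ->
  forall x, span (fun v => P v /\ exists g, H g v) x ->
  exists (s : seq G) (h : G -> V), (forall g, P (h g) /\ H g (h g)) /\
    forall t, uniq t -> {subset s <= t} -> x = \sum_(g <- t) h g.
Proof.
move=> P0 PD _ [r Pr ->]; elim: r Pr => [|v r IHr] Pr.
  exists [::], (fun=> 0); split=> [g|t _ _]; last by rewrite big_nil big1.
  by split=> //; apply: (grading0 HG).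
have [w wr|s [h [Ph hE]]] := IHr; first by apply: Pr; rewrite inE wr orbT.
have [|Pv [g0 Hv]] := Pr v; first by rewrite inE eqxx.
exists (g0 :: s), (fun g => (if g == g0 then v else 0) + h g); split=> [g|t ut st].
  have [Phg Hhg] := Ph g; case: eqP => [gE|_]; last by rewrite add0r.
  by split; [apply: PD|apply: gradingD => //; rewrite gE].
rewrite big_cons big_split /=; congr (_ + _).
  rewrite -big_mkcond -big_filter filter_pred1_uniq ?big_seq1 //.
  by apply: st; rewrite inE eqxx.
by apply: hE => // g gs; apply: st; rewrite inE gs orbT.
Qed.

Lemma homog_comp_mem (P : V -> Prop) : P 0 ->
  (forall x y, P x -> P y -> P (x + y)) ->
  (forall x, P x -> span (fun v => P v /\ exists g, H g v) x) ->
  forall (s : seq G) (f : G -> V), uniq s -> {in s, forall g, H g (f g)} ->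
  P (\sum_(g <- s) f g) -> {in s, forall g, P (f g)}.
Proof.
move=> P0 PD PS s f us Hf /PS /(span_homogP P0 PD)[t [h [Ph hE]]] g gs.
pose u := undup (s ++ t); pose f' g := if g \in s then f g else 0.
have su : {subset s <= u} by move=> i si; rewrite mem_undup mem_cat si.
have tu : {subset t <= u} by move=> i ti; rewrite mem_undup mem_cat ti orbT.
have uu : uniq u by apply: undup_uniq.
have f'E : \sum_(g <- u) f' g = \sum_(g <- s) f g.
  rewrite -big_mkcond -big_filter; apply: perm_big; apply: uniq_perm => //.
    by rewrite filter_uniq.
  by move=> i; rewrite mem_filter; case: (boolP (i \in s)) => //= /su.
have /(_ g) : {in u, forall g, f' g - h g = 0}.
  apply: (grading_indep HG) => //.
    move=> i _; apply: (gradingB HG); last by case: (Ph i).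
    by rewrite /f'; case: ifP => [/Hf//|_]; apply: (grading0 HG).
  by rewrite sumrB f'E -(hE u) // subrr.
rewrite /f' gs => /(_ (su _ gs)) /eqP; rewrite subr_eq0 => /eqP->.
by case: (Ph g).
Qed.

Lemma grading_sub (g0 : G) : is_grading (fun g => H (g - g0)).
Proof.
split=> [g|g|x|s f us Hf f0 g gs]; first exact: (grading0 HG).
- exact: (gradingB HG).
- have [r Hr ->] := grading_span HG x; exists r => // v /Hr[g Hg].
  by exists (g + g0); rewrite addrK.
- have := @grading_indep _ _ _ HG (map (fun g => g - g0) s) (fun g => f (g + g0)).
  rewrite map_inj_uniq ?big_map; last exact: addIr.
  move=> /(_ us) E; rewrite -[g](subrK g0); apply: E; last exact: map_f.
    by move=> _ /mapP[i /Hf Hi ->]; rewrite subrK.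
  by rewrite -[RHS]f0; apply: eq_bigr => i _; rewrite subrK.
Qed.

End GradingTheory.

Section RegularAndShift.
Variables (G : zmodType) (A : graded_ring G).

Definition regular_module : graded_module A :=
  @GradedModule G A A^o (@gr_homog G A) (@gr_grading G A) (@gr_homogM G A).

Variables (M : graded_module A) (d : G).

Lemma shift_homogZ g h (a : A) (x : M) :
  gr_homog g a -> gm_homog (h - d) x -> gm_homog (g + h - d) (a *: x).
Proof. by rewrite -addrA; apply: gm_homogZ. Qed.

(* M(-d), with M(-d)_g = M_(g - d) *)
Definition shift_module : graded_module A :=
  @GradedModule G A M (fun g => gm_homog (g - d))
    (grading_sub (gm_grading M) d) shift_homogZ.

End RegularAndShift.

Section QuotientModule.
Variables (G : zmodType) (A : graded_ring G) (M : graded_module A).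
Variable N : graded_submod M.

Definition gs_pred : {pred M} := fun x => `[< N x >].

Lemma gs_predP x : reflect (N x) (x \in gs_pred).
Proof. exact: asboolP. Qed.

Lemma gs_pred_zmod : zmod_closed gs_pred.
Proof.
split; first exact/gs_predP/gs_mem0.
by move=> x y /gs_predP Nx /gs_predP Ny; apply/gs_predP/gs_memB.
Qed.
HB.instance Definition _ := GRing.isZmodClosed.Build M gs_pred gs_pred_zmod.

Definition quot_type : Type := Quotient.quot gs_pred.
HB.instance Definition _ := GRing.Zmodule.on quot_type.

Definition qpi (x : M) : quot_type := \pi_(Quotient.quot gs_pred) x.

Lemma qpi_zmod : zmod_morphism qpi.
Proof. exact: pi_is_zmod_morphism. Qed.
HB.instance Definition _ := GRing.isZmodMorphism.Build M quot_type qpi qpi_zmod.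

Lemma qpi_eq x y : qpi x = qpi y <-> N (x - y).
Proof.
rewrite /qpi; split=> [/eqP|Nxy]; first by rewrite -Quotient.idealrBE => /gs_predP.
by apply/eqP; rewrite -Quotient.idealrBE; apply/gs_predP.
Qed.

Lemma qpi_eq0 x : qpi x = 0 <-> N x.
Proof. by rewrite -(raddf0 qpi) qpi_eq subr0. Qed.

Definition qrepr (x : quot_type) : M := repr (x : Quotient.quot gs_pred).

Lemma qreprK : cancel qrepr qpi.
Proof. exact: reprK. Qed.

Definition qscale (a : A) (x : quot_type) : quot_type := qpi (a *: qrepr x).

Lemma qscale_pi a x : qscale a (qpi x) = qpi (a *: x).
Proof.
by apply/qpi_eq; rewrite -scalerBr; apply/gs_memZ/qpi_eq/qreprK.
Qed.

Fact qscaleA a b x : qscale a (qscale b x) = qscale (a * b) x.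
Proof. by rewrite -[x]qreprK !qscale_pi scalerA. Qed.
Fact qscale1 : left_id 1 qscale.
Proof. by move=> x; rewrite -[x]qreprK qscale_pi scale1r. Qed.
Fact qscaleDr : right_distributive qscale +%R.
Proof.
move=> a x y; rewrite -[x]qreprK -[y]qreprK -raddfD !qscale_pi.
by rewrite scalerDr raddfD.
Qed.
Fact qscaleDl x : {morph qscale^~ x : a b / a + b}.
Proof. by move=> a b; rewrite -[x]qreprK !qscale_pi scalerDl raddfD. Qed.

HB.instance Definition _ := GRing.Zmodule_isLmodule.Build A quot_type
  qscaleA qscale1 qscaleDr qscaleDl.

Definition quot_homog (g : G) (x : quot_type) : Prop :=
  exists2 v : M, gm_homog g v & x = qpi v.

Lemma quot_grading : is_grading quot_homog.
Proof.
have MG := gm_grading M.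
split=> [g|g _ _ [x Hx ->] [y Hy ->]|x|s f us Hf f0].
- by exists 0; [apply: (grading0 MG)|rewrite raddf0].
- by exists (x - y); [apply: (gradingB MG)|rewrite raddfB].
- rewrite -[x]qreprK; apply: (span_map _ (grading_span MG (qrepr x))).
  by move=> v [g Hg]; apply: span_mem; exists g, v.
- have /choice[v Hv] : forall g, exists v : M,
      g \in s -> gm_homog g v /\ f g = qpi v.
    move=> g; case: (boolP (g \in s)) => [/Hf[v Hv ->]|_]; last by exists 0.
    by exists v.
  have fE : {in s, forall g, f g = qpi (v g)} by move=> g /Hv[].
  move=> g gs; rewrite fE //; apply/qpi_eq0; move: g gs.
  apply: (homog_comp_mem MG) => //.
  + exact: gs_mem0.
  + move=> x y Nx Ny; rewrite -[y]opprK; apply: gs_memB => //.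
    by rewrite -sub0r; apply: gs_memB => //; apply: gs_mem0.
  + exact: gs_memH.
  + by move=> g /Hv[].
  + by apply/qpi_eq0; rewrite raddf_sum -[RHS]f0; apply: eq_big_seq => g /fE.
Qed.

Lemma quot_homogZ g h (a : A) (x : quot_type) :
  gr_homog g a -> quot_homog h x -> quot_homog (g + h) (a *: x).
Proof.
move=> Ha [v Hv ->]; exists (a *: v); first exact: gm_homogZ.
exact: qscale_pi.
Qed.

Definition quot_module : graded_module A :=
  @GradedModule G A quot_type quot_homog quot_grading quot_homogZ.

End QuotientModule.

Section QuotientRing.
Variables (G : zmodType) (A : graded_ring G).
Variable I : graded_submod (regular_module A).

Definition qring_type : Type := quot_type I.
HB.instance Definition _ := GRing.Zmodule.on qring_type.

Definition rpi (x : A) : qring_type := @qpi G A (regular_module A) I x.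
Definition rrepr (x : qring_type) : A := @qrepr G A (regular_module A) I x.

Lemma rpi_zmod : zmod_morphism rpi.
Proof. exact: (@qpi_zmod G A (regular_module A) I). Qed.
HB.instance Definition _ := GRing.isZmodMorphism.Build A qring_type rpi rpi_zmod.

Lemma rreprK : cancel rrepr rpi.
Proof. exact: qreprK. Qed.

Definition qmul (x y : qring_type) : qring_type := rpi (rrepr x * rrepr y).

Lemma qmul_pi x y : qmul (rpi x) (rpi y) = rpi (x * y).
Proof.
have rE z : I (rrepr (rpi z) - z : A) by apply/qpi_eq/rreprK.
rewrite /qmul; set X := rrepr _; set Y := rrepr (rpi y).
suff: I (X * Y - x * y : A) by move=> ?; apply/qpi_eq.
have -> : X * Y - x * y = Y * (X - x) - (- x) * (Y - y).
  by rewrite mulNr opprK !mulrBr addrA [Y * x]mulrC subrK [Y * X]mulrC.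
exact: (gs_memB (gs_memZ Y (rE x)) (gs_memZ (- x) (rE y))).
Qed.

Fact qmulA : associative qmul.
Proof. by move=> x y z; rewrite -[x]rreprK -[y]rreprK -[z]rreprK !qmul_pi mulrA. Qed.
Fact qmulC : commutative qmul.
Proof. by move=> x y; rewrite -[x]rreprK -[y]rreprK !qmul_pi mulrC. Qed.
Fact qmul1 : left_id (rpi 1) qmul.
Proof. by move=> x; rewrite -[x]rreprK qmul_pi mul1r. Qed.
Fact qmulD : left_distributive qmul +%R.
Proof.
move=> x y z; rewrite -[x]rreprK -[y]rreprK -[z]rreprK -raddfD !qmul_pi.
by rewrite mulrDl raddfD.
Qed.

HB.instance Definition _ := GRing.Zmodule_isComPzRing.Build qring_type
  qmulA qmulC qmul1 qmulD.

Lemma qring_homog1 : @quot_homog G A (regular_module A) I 0 (1 : qring_type).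
Proof. by exists (1 : A) => //; apply: gr_homog1. Qed.

Lemma qring_homogM g h (x y : qring_type) :
  @quot_homog G A (regular_module A) I g x ->
  @quot_homog G A (regular_module A) I h y ->
  @quot_homog G A (regular_module A) I (g + h) (x * y).
Proof.
move=> [v Hv ->] [w Hw ->]; exists (v * w : A); first exact: gr_homogM.
exact: qmul_pi.
Qed.

Definition quot_ring : graded_ring G :=
  @GradedRing G qring_type (@quot_homog G A (regular_module A) I)
    (quot_grading I) qring_homog1 qring_homogM.

End QuotientRing.

Definition ideal_gen (A : comPzRingType) (fs : seq A) : A -> Prop :=
  span (fun x => exists a f, f \in fs /\ x = a * f).

Definition regular_sequence (A : comPzRingType) (fs : seq A) : Prop :=
  (forall i, (i < size fs)%N -> forall x,
     ideal_gen (take i fs) (fs`_i * x) -> ideal_gen (take i fs) x)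
  /\ ~ ideal_gen fs 1.

Section HomogeneousIdeal.
Variables (G : zmodType) (A : graded_ring G) (fs : seq A) (d : G).
Hypothesis fs_homog : {in fs, forall f, gr_homog d f}.

Lemma ideal_genB x y : ideal_gen fs x -> ideal_gen fs y -> ideal_gen fs (x - y).
Proof.
apply: spanB => _ [a [f [ff ->]]]; exists (- a), f; split=> //.
by rewrite mulNr.
Qed.

Lemma ideal_genZ a x : ideal_gen fs x -> ideal_gen fs (a * x).
Proof.
elim/span_ind: x / => [|u v Iu Iv|_ [b [f [ff ->]]]].
- by rewrite mulr0; apply: span0.
- by rewrite mulrDr; apply: spanD.
- by apply: span_mem; exists (a * b), f; rewrite mulrA.
Qed.

Lemma ideal_genH x : ideal_gen fs x ->
  span (fun v => ideal_gen fs v /\ exists g, gr_homog g v) x.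
Proof.
elim/span_ind: x / => [|u v Iu Iv|_ [b [f [ff ->]]]].
- exact: span0.
- exact: spanD.
- elim/span_ind: b / (grading_span (gr_grading A) b) => [|u v Iu Iv|u [g Hu]].
  + by rewrite mul0r; apply: span0.
  + by rewrite mulrDl; apply: spanD.
  + apply: span_mem; split; first by apply: span_mem; exists u, f.
    by exists (g + d); apply: gr_homogM => //; apply: fs_homog.
Qed.

Definition homog_ideal : graded_submod (regular_module A) :=
  @GradedSubmod G A (regular_module A) (ideal_gen fs) (span0 _)
    ideal_genB ideal_genZ ideal_genH.

End HomogeneousIdeal.

Section Diagonal.
Variable A : graded_ring (int * int)%type.

Definition diag_mem (M : graded_module A) : {pred M} :=
  fun x => `[< span (fun v : M => exists i : int, gm_homog (i, i) v) x >].
Arguments diag_mem : clear implicits.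

Lemma diag_memP (M : graded_module A) (x : M) :
  reflect (span (fun v : M => exists i : int, gm_homog (i, i) v) x)
          (x \in diag_mem M).
Proof. exact: asboolP. Qed.

Lemma diag_mem_zmod M : zmod_closed (diag_mem M).
Proof.
split=> [|x y /diag_memP Dx /diag_memP Dy]; apply/diag_memP; first exact: span0.
by apply: spanB => // v [i Hv]; exists i; apply: (gradingN (gm_grading M)).
Qed.
HB.instance Definition _ M :=
  GRing.isZmodClosed.Build (gm_sort M) (diag_mem M) (diag_mem_zmod M).

Lemma diag_memZ (M : graded_module A) (a : A) (x : M) :
  a \in diag_mem (regular_module A) -> x \in diag_mem M ->
  a *: x \in diag_mem M.
Proof.
move=> /diag_memP Da /diag_memP Dx; apply/diag_memP.
elim/span_ind: Da => [|u v Iu Iv|u [i Hu]].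
- by rewrite scale0r; apply: span0.
- by rewrite scalerDl; apply: spanD.
- elim/span_ind: Dx => [|v w Iv Iw|v [j Hv]].
  + by rewrite scaler0; apply: span0.
  + by rewrite scalerDr; apply: spanD.
  + by apply: span_mem; exists (i + j); apply: (gm_homogZ Hu Hv).
Qed.

Section DiagGrading.
Variable M : graded_module A.

Definition diag_type : Type := {x : M | x \in diag_mem M}.
HB.instance Definition _ := SubChoice.on diag_type.
HB.instance Definition _ := [SubChoice_isSubZmodule of diag_type by <:].

Definition diag_homog (i : int) (x : diag_type) : Prop := gm_homog (i, i) (val x).

Lemma diag_grading : is_grading diag_homog.
Proof.
have MG := gm_grading M.
split=> [i|i x y|x|s f us Hf f0 i si].
- by rewrite /diag_homog raddf0; apply: (grading0 MG).
- by rewrite /diag_homog raddfB; apply: (gradingB MG).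
- have /diag_memP[s Ps xE] := valP x.
  have sub v : v \in s -> val (insubd (0 : diag_type) v) = v.
    by move=> /Ps Dv; rewrite insubdK //; apply/diag_memP/span_mem.
  exists (map (insubd (0 : diag_type)) s).
    move=> _ /mapP[v vs ->]; have [i Hv] := Ps _ vs; exists i.
    by rewrite /diag_homog sub.
  apply: val_inj; rewrite raddf_sum big_map {1}xE.
  by apply: eq_big_seq => v /sub.
- apply: val_inj; rewrite raddf0.
  have := @grading_indep _ _ _ MG (map (fun i => (i, i)) s) (fun g => val (f g.1)).
  rewrite map_inj_uniq ?big_map; last by move=> a b [].
  move=> /(_ us) E; apply: (E _ _ (i, i)); last exact: map_f.
    by move=> _ /mapP[j /Hf Hj ->].
  by rewrite -raddf_sum f0 raddf0.
Qed.

End DiagGrading.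

Definition diag_ring_type : Type := diag_type (regular_module A).
HB.instance Definition _ := GRing.Zmodule.on diag_ring_type.

Lemma diag_ring_closed1 : (1 : A) \in diag_mem (regular_module A).
Proof. by apply/diag_memP/span_mem; exists 0; apply: gr_homog1. Qed.

Definition diag_one : diag_ring_type := Sub (1 : A) diag_ring_closed1.
Definition diag_mul (x y : diag_ring_type) : diag_ring_type :=
  Sub (val x * val y : A) (diag_memZ (valP x) (valP y)).

Fact diag_mulA : associative diag_mul.
Proof. by move=> x y z; apply: val_inj; apply: mulrA. Qed.
Fact diag_mulC : commutative diag_mul.
Proof. by move=> x y; apply: val_inj; apply: mulrC. Qed.
Fact diag_mul1 : left_id diag_one diag_mul.
Proof. by move=> x; apply: val_inj; apply: mul1r. Qed.
Fact diag_mulD : left_distributive diag_mul +%R.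
Proof. by move=> x y z; apply: val_inj; apply: mulrDl. Qed.

HB.instance Definition _ := GRing.Zmodule_isComPzRing.Build diag_ring_type
  diag_mulA diag_mulC diag_mul1 diag_mulD.

Lemma diag_ring_homog1 : @diag_homog (regular_module A) 0 (1 : diag_ring_type).
Proof. exact: gr_homog1. Qed.

Lemma diag_ring_homogM i j (x y : diag_ring_type) :
  @diag_homog (regular_module A) i x -> @diag_homog (regular_module A) j y ->
  @diag_homog (regular_module A) (i + j) (x * y).
Proof. exact: gr_homogM. Qed.

Definition diag_ring : graded_ring int :=
  @GradedRing int diag_ring_type (@diag_homog (regular_module A))
    (diag_grading (regular_module A)) diag_ring_homog1 diag_ring_homogM.

Section DiagModule.
Variable M : graded_module A.

Definition diag_scale (a : diag_ring) (x : diag_type M) : diag_type M :=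
  Sub (val a *: val x) (diag_memZ (valP a) (valP x)).

Fact diag_scaleA a b x : diag_scale a (diag_scale b x) = diag_scale (a * b) x.
Proof. by apply: val_inj; apply: scalerA. Qed.
Fact diag_scale1 : left_id 1 diag_scale.
Proof. by move=> x; apply: val_inj; apply: scale1r. Qed.
Fact diag_scaleDr : right_distributive diag_scale +%R.
Proof. by move=> a x y; apply: val_inj; apply: scalerDr. Qed.
Fact diag_scaleDl x : {morph diag_scale^~ x : a b / a + b}.
Proof. by move=> a b; apply: val_inj; apply: scalerDl. Qed.

HB.instance Definition _ := GRing.Zmodule_isLmodule.Build diag_ring (diag_type M)
  diag_scaleA diag_scale1 diag_scaleDr diag_scaleDl.

Lemma diag_homogZ i j (a : diag_ring) (x : diag_type M) :
  gr_homog i a -> diag_homog j x -> diag_homog (i + j) (a *: x).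
Proof. by move=> Ha Hx; exact: (gm_homogZ (g := (i, i)) (h := (j, j)) Ha Hx). Qed.

Definition diag_module : graded_module diag_ring :=
  @GradedModule int diag_ring (diag_type M) (@diag_homog M)
    (diag_grading M) diag_homogZ.

End DiagModule.
End Diagonal.

(* In this section [A] stands for a standard graded [K]-algebra, so that the
   residue module A/A_+ is [K].  None of the notions involves the [K]-linear
   structure, which is therefore left implicit. *)
Section Regularity.
Variable A : graded_ring int.

(* A_+ V *)
Definition irr_mul (V : lmodType A) : V -> Prop :=
  span (fun x => exists (i : int) (a : A) (v : V),
    [/\ 0 < i, gr_homog i a & x = a *: v]).

Lemma irr_mulB (V : lmodType A) (x y : V) :
  irr_mul x -> irr_mul y -> irr_mul (x - y).
Proof.
apply: spanB => _ [i [a [v [i0 Ha ->]]]]; exists i, a, (- v); split=> //.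
by rewrite scalerN.
Qed.

Lemma irr_mulZ (V : lmodType A) (b : A) (x : V) : irr_mul x -> irr_mul (b *: x).
Proof.
elim/span_ind: x / => [|u v Iu Iv|_ [i [a [v [i0 Ha ->]]]]].
- by rewrite scaler0; apply: span0.
- by rewrite scalerDr; apply: spanD.
- apply: span_mem; exists i, a, (b *: v).
  by rewrite !scalerA mulrC.
Qed.

Lemma irr_mulH (M : graded_module A) (x : M) : irr_mul x ->
  span (fun v => irr_mul v /\ exists i, gm_homog i v) x.
Proof.
elim/span_ind: x / => [|u v Iu Iv|_ [i [a [v [i0 Ha ->]]]]].
- exact: span0.
- exact: spanD.
- elim/span_ind: v / (grading_span (gm_grading M) v) => [|u v Iu Iv|u [j Hu]].
  + by rewrite scaler0; apply: span0.
  + by rewrite scalerDr; apply: spanD.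
  + apply: span_mem; split; first by apply: span_mem; exists i, a, u.
    by exists (i + j); apply: gm_homogZ.
Qed.

Definition irrelevant_ideal : graded_submod (regular_module A) :=
  @GradedSubmod int A (regular_module A) (@irr_mul A^o) (span0 _)
    (@irr_mulB A^o) (@irr_mulZ A^o) (@irr_mulH (regular_module A)).

(* The graded module K = A/A_+. *)
Definition residue_module : graded_module A := quot_module irrelevant_ideal.

Definition graded_free (F : graded_module A) : Prop :=
  exists (B : choiceType) (deg : B -> int) (e : B -> F),
  [/\ forall b, gm_homog (deg b) (e b),
      forall x, exists (s : seq B) (c : B -> A), x = \sum_(b <- s) c b *: e b
    & forall (s : seq B) (c : B -> A), uniq s ->
        \sum_(b <- s) c b *: e b = 0 -> {in s, forall b, c b = 0}].

Record free_resolution (M : graded_module A) := FreeResolution {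
  res_mod : nat -> graded_module A;
  res_d : forall i, {linear res_mod i.+1 -> res_mod i};
  res_aug : {linear res_mod 0%N -> M};
  res_free : forall i, graded_free (res_mod i);
  res_d_homog : forall i j x, gm_homog j x -> gm_homog j (res_d i x);
  res_aug_homog : forall j x, gm_homog j x -> gm_homog j (res_aug x);
  res_aug_surj : forall y, exists x, res_aug x = y;
  res_exact0 : forall x, res_aug x = 0 <-> exists y, x = res_d 0%N y;
  res_exact : forall i x, res_d i x = 0 <-> exists y, x = res_d i.+1 y }.

(* F (x)_A K is identified with F / A_+ F: the next two predicates describe the
   elements of F_i whose classes are cycles, respectively boundaries, of the
   complex F (x)_A K. *)
Definition res_cycle M (F : free_resolution M) (i : nat) : res_mod F i -> Prop :=
  match i with
  | 0%N => fun=> True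
  | i'.+1 => fun x => irr_mul (res_d F i' x)
  end.

Definition res_boundary M (F : free_resolution M) (i : nat) (x : res_mod F i) :
    Prop :=
  exists y, irr_mul (x - res_d F i y).

(* Tor_i^A(M, K)_j <> 0.  Tor does not depend on the resolution, so that the
   existential quantifier could as well be a universal one. *)
Definition Tor_neq0 (M : graded_module A) (i : nat) (j : int) : Prop :=
  exists (F : free_resolution M) (x : res_mod F i),
    [/\ gm_homog j x, res_cycle x & ~ res_boundary x].

(* The supremum in Z with both infinities added; it is -oo for M = 0. *)
Definition reg (M : graded_module A) : \bar int :=
  supremum -oo%E
    [set r : \bar int | exists (i : nat) (j : int),
       Tor_neq0 M i j /\ r = (j - i%:Z)%:E]%classic.

Definition generated_in_degree (M : graded_module A) (d : int) : Prop :=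
  forall x : M, span (fun y => exists (a : A) (v : M),
    gm_homog d v /\ y = a *: v) x.

Definition has_linear_resolution (M : graded_module A) : Prop :=
  exists d : int, generated_in_degree M d /\ reg M = d%:E.

Definition koszul : Prop := has_linear_resolution residue_module.

End Regularity.

Section BigradedPolynomials.
Variables (K : fieldType) (m n : nat).

(* The variables x_1, ..., x_m, t_1, ..., t_n are 'X_k for k : 'I_(m + n), the
   first m of which are the x_i. *)
Definition bideg (u : 'X_{1..m + n}) : int * int :=
  ((\sum_(i < m) u (lshift n i))%N%:Z, (\sum_(j < n) u (rshift m j))%N%:Z).

Definition bihomog (g : int * int) (p : {mpoly K[m + n]}) : Prop :=
  {in msupp p, forall u, bideg u = g}.

Lemma bihomogP g p : bihomog g p <-> forall u, p@_u != 0 -> bideg u = g.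
Proof. by split=> Hp u; have := Hp u; rewrite mcoeff_msupp. Qed.

Lemma bihomog_grading : is_grading bihomog.
Proof.
split=> [g|g p q /bihomogP Hp /bihomogP Hq|p|s f us Hf f0 g gs].
- by move=> u; rewrite msupp0.
- apply/bihomogP => u; rewrite mcoeffB.
  have [p0|/Hp//] := eqVneq p@_u 0; have [q0|/Hq//] := eqVneq q@_u 0.
  by rewrite p0 q0 subr0 eqxx.
- exists [seq p@_u *: 'X_[u] | u <- msupp p]; last by rewrite big_map -mpolyE.
  move=> _ /mapP[u _ ->]; exists (bideg u); apply/bihomogP => v.
  rewrite mcoeffZ mcoeffX; have [->//|_] := eqVneq u v.
  by rewrite mulr0 eqxx.
- apply/mpolyP => u; rewrite mcoeff0; apply/eqP; apply: contraT => fu.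
  have gE : bideg u = g by have /bihomogP := Hf g gs; apply.
  have: (\sum_(h <- s) f h)@_u = 0 by rewrite f0 mcoeff0.
  rewrite raddf_sum (bigD1_seq g) //= big_seq_cond big1 ?addr0 => [/eqP|h].
    by rewrite (negPf fu).
  case/andP=> hs; apply: contraNeq => hu.
  by have /bihomogP/(_ _ hu)  := Hf h hs; rewrite gE => ->.
Qed.

Lemma bidegD u v : bideg (u + v)%MM = bideg u + bideg v.
Proof.
rewrite /bideg; under eq_bigr do rewrite mnmDE.
under [X in (_, X%:Z)]eq_bigr do rewrite mnmDE.
by rewrite !big_split !PoszD.
Qed.

Lemma bihomog1 : bihomog 0 1.
Proof.
move=> u; rewrite msupp1 inE => /eqP ->; rewrite /bideg.
by rewrite !big1 // => i _; rewrite mnm0E.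
Qed.

Lemma bihomogM g h p q : bihomog g p -> bihomog h q -> bihomog (g + h) (p * q).
Proof.
move=> Hp Hq w /msuppM_le /allpairsP[[u v] /= [up vq ->]].
by rewrite bidegD Hp // Hq.
Qed.

Definition bigraded_mpoly : graded_ring (int * int)%type :=
  @GradedRing (int * int)%type {mpoly K[m + n]} bihomog
    bihomog_grading bihomog1 bihomogM.

End BigradedPolynomials.

(* Main.v *)
Require Import Defs.
From HB Require Import structures.
From mathcomp Require Import all_boot all_order all_algebra.
From mathcomp Require Import mpoly zify.
From mathcomp Require Import boolp classical_sets constructive_ereal.
(* [Defs.span] has been shadowed by [vector.span]. *)
Require Import Defs.

(* Write M(a, b) for R(-a, -b)_Delta; the main point is that M(a, b) has
   regularity at most max(a, b), by induction on the length of the regular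
   sequence.  Let R = R'/(f).  The exact sequence
     0 -> M'(a + 2, b + 1) -> M'(a, b) -> M(a, b) -> 0
   over R'_Delta bounds the regularity of M(a, b) over R'_Delta by
   max(a + 1, b); for a = b it shows that R_Delta has regularity at most 1 over
   R'_Delta, so that regularity does not increase from R'_Delta to R_Delta.
   This settles the case a < b.  For a > b, resolve M(a, b) by the modules
   M(a, b + i), i > 0, through the Koszul complex of t_1, ..., t_n on R: it is
   not exact, but an f-multiplication chase from R' to R shows that it has no
   homology in bidegrees (p, q) with p < q, and none in positive homological
   degree when p = q.  The latter also resolves K by the M(0, i), which gives
   the Koszul property.  For the polynomial ring itself, the case a < b uses the
   Koszul complex of x_1, ..., x_m instead. *)

Set Implicit Arguments.
Unset Strict Implicit.
Unset Printing Implicit Defensive.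

Import Order.TTheory GRing.Theory Num.Theory.
Local Open Scope ring_scope.

(** * Graded modules and their homomorphisms *)

(** The asymmetry of (2, 1) decides which complex serves where. In the chase through multiplication
    by f a total bidegree (p, q) becomes (p - 2, q - 1). The condition p <= q survives this and q <=
    p does not, so the chase works for the Koszul complex of the t_i but not for that of the x_i,
    and after division by f the case a < b has to come from R'. There a + 2 <= b + 1, so that max(a
    + 2, b + 1) exceeds max(a, b) by 1 only. Upper bounds are proved for [reg_le], which concerns
    finitely many steps of a possibly non-minimal resolution by finite free modules. Horseshoe and
    pullback constructions replace the long exact sequence of Tor; Tor itself enters only once a
    bound holds for every length. The inductions run on this length: in a Koszul resolution of M(a,
    b) each later term needs one step less, and only the first needs as many as M(a, b). Equality
    then comes from degrees: M(a, b) vanishes below max(a, b) but not in that degree, so Tor_0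
    attains the bound. *)

Lemma span_sum (V : zmodType) (I : Type) (P : V -> Prop) (r : seq I)
    (F : I -> V) : (forall i, span P (F i)) -> span P (\sum_(i <- r) F i).
Proof.
move=> PF; elim/big_ind: _ => [|x y|//]; [exact: span0|exact: spanD].
Qed.

Section Components.
Variables (G V : zmodType) (H : G -> V -> Prop).
Hypothesis HG : is_grading H.

(** Summing over every duplicate-free [t] that contains [s] forces [f] to vanish outside [s]: this
    encodes finite support. *)
Definition decomposes (x : V) (f : G -> V) : Prop :=
  (forall g, H g (f g)) /\ exists s : seq G, forall t, uniq t ->
    {subset s <= t} -> x = \sum_(g <- t) f g.

Lemma decomposition x : exists f, decomposes x f.
Proof.
have [|||s [h [Ph hE]]] := @span_homogP _ _ _ HG (fun=> True) _ _ x.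
- by [].
- by [].
- have [r Hr ->] := grading_span HG x.
  by exists r => // v /Hr[g Hg]; split=> //; exists g.
- by exists h; split; [move=> g; case: (Ph g)|exists s].
Qed.

Lemma decomposes_inj x f h : decomposes x f -> decomposes x h -> f =1 h.
Proof.
move=> [Hf [s sE]] [Hh [t tE]] g; pose u := undup (g :: s ++ t).
have uu : uniq u := undup_uniq _.
have su : {subset s <= u}.
  by move=> i si; rewrite mem_undup inE mem_cat si orbT.
have tu : {subset t <= u}.
  by move=> i ti; rewrite mem_undup inE mem_cat ti !orbT.
apply/subr0_eq/(@grading_indep _ _ _ HG u (fun g => f g - h g)) => //.
- by move=> i _; apply: (gradingB HG).
- by rewrite sumrB -sE // -tE // subrr.
- by rewrite mem_undup inE eqxx.
Qed.

Definition hcomp (g : G) (x : V) : V := projT1 (cid (decomposition x)) g.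

Lemma hcomp_decomposes x : decomposes x (hcomp^~ x).
Proof. by rewrite /hcomp; case: cid. Qed.

Lemma hcompE x f g : decomposes x f -> hcomp g x = f g.
Proof. by move=> xf; apply: decomposes_inj (hcomp_decomposes x) xf g. Qed.

Lemma hcompP g x : H g (hcomp g x).
Proof. by have [] := hcomp_decomposes x. Qed.

Lemma hcomp_sum x : exists s : seq G, forall t, uniq t ->
  {subset s <= t} -> x = \sum_(g <- t) hcomp g x.
Proof. by have [] := hcomp_decomposes x. Qed.

Lemma hcomp_eq0 x : (forall g, hcomp g x = 0) -> x = 0.
Proof.
move=> x0; have [s sE] := hcomp_sum x.
rewrite (sE (undup s)) ?undup_uniq // => [|g gs]; last by rewrite mem_undup.
exact: big1.
Qed.

Lemma hcomp_homog h g x : H g x -> hcomp h x = if h == g then x else 0.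
Proof.
move=> Hx; apply: (@hcompE _ (fun h => if h == g then x else 0)); split.
  by move=> i; case: eqP => [->|_] //; apply: (grading0 HG).
exists [:: g] => t ut st; rewrite -big_mkcond -big_filter filter_pred1_uniq //.
  by rewrite big_seq1.
by apply: st; rewrite inE.
Qed.

Lemma hcomp_id g x : H g x -> hcomp g x = x.
Proof. by move=> /hcomp_homog ->; rewrite eqxx. Qed.

Lemma hcompB g : {morph hcomp g : x y / x - y}.
Proof.
move=> x y; apply: (@hcompE _ (fun g => hcomp g x - hcomp g y)); split.
  by move=> i; apply: (gradingB HG); apply: hcompP.
have [s sE] := hcomp_sum x; have [r rE] := hcomp_sum y.
exists (s ++ r) => t ut st; rewrite sumrB -sE -?rE // => i ir;
  by apply: st; rewrite mem_cat ir ?orbT.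
Qed.

HB.instance Definition _ g :=
  GRing.isZmodMorphism.Build V V (hcomp g) (@hcompB g).

Lemma grading_sum (I : Type) (r : seq I) (P : pred I) (F : I -> V) g :
  (forall i, P i -> H g (F i)) -> H g (\sum_(i <- r | P i) F i).
Proof.
move=> HF; elim/big_ind: _ => //; first exact: (grading0 HG).
exact: (gradingD HG).
Qed.

Lemma hcomp_closed (P : V -> Prop) : P 0 ->
  (forall x y, P x -> P y -> P (x + y)) ->
  (forall x, P x -> span (fun v => P v /\ exists g, H g v) x) ->
  forall g x, P x -> P (hcomp g x).
Proof.
move=> P0 PD PS g x /PS/(span_homogP HG P0 PD)[s [h [Ph hE]]].
rewrite (@hcompE x h); first by case: (Ph g).
by split; [move=> i; case: (Ph i)|exists s].
Qed.

End Components.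

(** The degree map [s] is the identity for a [ghom] and a translation for multiplication by a
    homogeneous scalar. Injectivity keeps the images of distinct components in distinct degrees. *)
Lemma hcomp_map (G V W : zmodType) (H : G -> V -> Prop) (K : G -> W -> Prop)
    (HG : is_grading H) (KG : is_grading K) (F : {additive V -> W}) (s : G -> G) :
  injective s -> (forall g x, H g x -> K (s g) (F x)) ->
  forall g x, hcomp KG (s g) (F x) = F (hcomp HG g x).
Proof.
move=> s_inj HF g x; have [t tE] := hcomp_sum HG x.
rewrite [in LHS](tE (undup (g :: t))) ?undup_uniq //; last first.
  by move=> i it; rewrite mem_undup inE it orbT.
rewrite !raddf_sum (bigD1_seq g) ?undup_uniq ?mem_undup ?inE ?eqxx //=.
rewrite (hcomp_id KG); last by apply: HF; apply: hcompP.
rewrite big1 ?addr0 // => i /negPf ig.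
rewrite (hcomp_homog _ _ (HF _ _ (hcompP HG i x))).
by rewrite (inj_eq s_inj) eq_sym ig.
Qed.

Notation gcomp := (hcomp (gm_grading _)).

Section GradedHom.
Variables (G : zmodType) (A : graded_ring G).

Structure ghom (M N : graded_module A) := GHom {
  ghom_fun :> M -> N;
  ghom_linear : linear ghom_fun;
  ghom_homog : forall g x, gm_homog g x -> gm_homog g (ghom_fun x) }.

HB.instance Definition _ M N (f : ghom M N) :=
  GRing.isLinear.Build A M N *:%R (ghom_fun f) (@ghom_linear M N f).

Lemma ghomZ M N (f : ghom M N) (a : A) x : f (a *: x) = a *: f x.
Proof. exact: linearZ. Qed.
Lemma ghomD M N (f : ghom M N) : {morph f : x y / x + y}.
Proof. exact: raddfD. Qed.
Lemma ghomB M N (f : ghom M N) : {morph f : x y / x - y}.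
Proof. exact: raddfB. Qed.
Lemma ghomN M N (f : ghom M N) : {morph f : x / - x}.
Proof. exact: raddfN. Qed.
Lemma ghom0 M N (f : ghom M N) : f 0 = 0.
Proof. exact: raddf0. Qed.

Lemma ghom_sum M N (f : ghom M N) (I : Type) (r : seq I) (E : I -> M) :
  f (\sum_(i <- r) E i) = \sum_(i <- r) f (E i).
Proof. exact: raddf_sum. Qed.

Definition surj (U V : Type) (f : U -> V) : Prop := forall y, exists x, f x = y.

Definition ses (L M N : graded_module A) : Prop :=
  exists (i : ghom L M) (p : ghom M N),
    [/\ injective i, surj p & forall x, p x = 0 <-> exists y, x = i y].

Lemma ghom_gcomp (M N : graded_module A) (f : ghom M N) g x :
  gcomp g (f x) = f (gcomp g x).
Proof. exact/(@hcomp_map _ _ _ _ _ _ _ f id)/ghom_homog. Qed.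

Lemma gcompZ (M : graded_module A) g h (a : A) (x : M) : gr_homog g a ->
  gcomp (g + h) (a *: x) = a *: gcomp h x.
Proof.
move=> Ha; apply: (@hcomp_map _ _ _ _ _ _ (gm_grading M) ( *:%R a) (+%R g)).
  exact: addrI.
by move=> i y; apply: gm_homogZ.
Qed.

Lemma gcompZr (M : graded_module A) g h (a : A) (x : M) : gm_homog h x ->
  gcomp (g + h) (a *: x) = hcomp (gr_grading A) g a *: x.
Proof.
move=> Hx; have [t tE] := hcomp_sum (gr_grading A) a.
rewrite {1}(tE (undup (g :: t))) ?undup_uniq //; last first.
  by move=> i it; rewrite mem_undup inE it orbT.
rewrite scaler_suml raddf_sum (bigD1_seq g) ?undup_uniq ?mem_undup ?inE ?eqxx //=.
rewrite [hcomp _ _ _]hcomp_id; last by apply: gm_homogZ Hx; apply: hcompP.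
rewrite big1 ?addr0 // => i /negPf ig.
rewrite [hcomp (gm_grading _) _ _](hcomp_homog _ _ (gm_homogZ (hcompP _ _ _) Hx)).
by rewrite (inj_eq (addIr h)) eq_sym ig.
Qed.

Lemma homog_lift (M N : graded_module A) (f : ghom M N) : surj f ->
  forall g y, gm_homog g y -> exists2 x, gm_homog g x & f x = y.
Proof.
move=> f_surj g y Hy; have [x fx] := f_surj y.
exists (gcomp g x); first exact: hcompP.
by rewrite -ghom_gcomp fx; apply: hcomp_id.
Qed.

Lemma ghom_id_linear (M : graded_module A) : linear (@id M).
Proof. by []. Qed.
Definition ghom_id (M : graded_module A) : ghom M M :=
  GHom (@ghom_id_linear M) (fun g x Hx => Hx).

Lemma ghom_0_linear (M N : graded_module A) : linear (fun _ : M => 0 : N).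
Proof. by move=> a x y; rewrite scaler0 addr0. Qed.
Definition ghom_0 (M N : graded_module A) : ghom M N :=
  GHom (@ghom_0_linear M N) (fun g x _ => grading0 (gm_grading N) g).

Section Comp.
Variables (L M N : graded_module A) (f : ghom M N) (h : ghom L M).
Lemma ghom_comp_linear : linear (f \o h).
Proof. by move=> a x y; rewrite /= !linearP. Qed.
Lemma ghom_comp_homog g x : gm_homog g x -> gm_homog g (f (h x)).
Proof. by move=> Hx; do 2!apply: ghom_homog. Qed.
Definition ghom_comp : ghom L N := GHom ghom_comp_linear ghom_comp_homog.
End Comp.

Section Sub.
Variables (M N : graded_module A) (f h : ghom M N).
Lemma ghom_sub_linear : linear (fun x => f x - h x).
Proof. by move=> a x y; rewrite !ghom_linear scalerBr opprD addrACA. Qed.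
Lemma ghom_sub_homog g x : gm_homog g x -> gm_homog g (f x - h x).
Proof. by move=> Hx; apply: (gradingB (gm_grading N)); apply: ghom_homog. Qed.
Definition ghom_sub : ghom M N := GHom ghom_sub_linear ghom_sub_homog.
End Sub.

Lemma ghom_factor (L M N : graded_module A) (i : ghom L M) (f : ghom N M) :
  injective i -> (forall x, exists y, f x = i y) ->
  exists h : ghom N L, forall x, i (h x) = f x.
Proof.
move=> i_inj /choice[h hE].
have h_lin : linear h.
  by move=> a x y; apply: i_inj; rewrite ghom_linear -!hE ghom_linear.
have h_homog g x : gm_homog g x -> gm_homog g (h x).
  move=> Hx; suff -> : h x = gcomp g (h x) by apply: hcompP.
  apply: i_inj; rewrite -ghom_gcomp -hE.
  by rewrite [RHS]hcomp_id //; apply: ghom_homog Hx.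
by exists (GHom h_lin h_homog) => x /=; rewrite -hE.
Qed.

Lemma exact_homog (L M N : graded_module A) (f : ghom L M) (h : ghom M N) :
  (forall g y, gm_homog g y -> h y = 0 -> exists x, y = f x) ->
  forall y, h y = 0 -> exists x, y = f x.
Proof.
move=> exact_h y hy.
have /choice[k kE] g : exists x, gcomp g y = f x.
  apply: (exact_h g); first exact: hcompP.
  by rewrite -ghom_gcomp hy; apply: raddf0.
have [t tE] := hcomp_sum (gm_grading M) y.
exists (\sum_(g <- undup t) k g); rewrite raddf_sum (tE (undup t)).
- by apply: eq_bigr => g _; apply: kE.
- exact: undup_uniq.
- by move=> g; rewrite mem_undup.
Qed.

Lemma surj_homog (M N : graded_module A) (f : ghom M N) :
  (forall g y, gm_homog g y -> exists x, y = f x) -> surj f.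
Proof.
move=> f_surj y; have [||x ->] := @exact_homog _ _ N f (ghom_0 N N) _ y.
- by move=> g z Hz _; apply: f_surj Hz.
- by [].
- by exists x.
Qed.

Section Submodule.
Variables (M : graded_module A) (N : graded_submod M).

Definition sub_type : Type := {x : M | x \in gs_pred N}.
HB.instance Definition _ := SubChoice.on sub_type.
HB.instance Definition _ := [SubChoice_isSubZmodule of sub_type by <:].

Lemma sub_scale_mem (a : A) (x : sub_type) : a *: val x \in gs_pred N.
Proof. exact/gs_predP/gs_memZ/gs_predP/(valP x). Qed.

Definition sub_scale (a : A) (x : sub_type) : sub_type := Sub (a *: val x : M) (sub_scale_mem a x).

Fact sub_scaleA a b x : sub_scale a (sub_scale b x) = sub_scale (a * b) x.
Proof. by apply: val_inj; apply: scalerA. Qed.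
Fact sub_scale1 : left_id 1 sub_scale.
Proof. by move=> x; apply: val_inj; apply: scale1r. Qed.
Fact sub_scaleDr : right_distributive sub_scale +%R.
Proof. by move=> a x y; apply: val_inj; apply: scalerDr. Qed.
Fact sub_scaleDl x : {morph sub_scale^~ x : a b / a + b}.
Proof. by move=> a b; apply: val_inj; apply: scalerDl. Qed.
HB.instance Definition _ := GRing.Zmodule_isLmodule.Build A sub_type
  sub_scaleA sub_scale1 sub_scaleDr sub_scaleDl.

Definition sub_homog (g : G) (x : sub_type) : Prop := gm_homog g (val x).

Lemma sub_grading : is_grading sub_homog.
Proof.
have MG := gm_grading M.
have NP g x : N x -> N (gcomp g x).
  apply: hcomp_closed; [exact: gs_mem0| |exact: gs_memH].
  move=> u v Nu Nv; rewrite -[v]opprK; apply: gs_memB => //.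
  by rewrite -sub0r; apply: gs_memB => //; apply: gs_mem0.
split=> [g|g x y|x|s f us Hf f0 g gs].
- by rewrite /sub_homog raddf0; apply: (grading0 MG).
- by rewrite /sub_homog raddfB; apply: (gradingB MG).
- have [t tE] := hcomp_sum (gm_grading M) (val x).
  have Nc g : gcomp g (val x) \in gs_pred N.
    exact/gs_predP/NP/gs_predP/(valP x).
  exists [seq Sub (gcomp g (val x)) (Nc g) : sub_type | g <- undup t].
    by move=> _ /mapP[g _ ->]; exists g; apply: hcompP.
  apply: val_inj; rewrite raddf_sum big_map [LHS](tE (undup t)) ?undup_uniq //.
  by move=> g; rewrite mem_undup.
- apply: val_inj; rewrite raddf0.
  apply: (@grading_indep _ _ _ MG s (fun g => val (f g))) => //.
  by rewrite -raddf_sum f0 raddf0.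
Qed.

Lemma sub_homogZ g h (a : A) (x : sub_type) :
  gr_homog g a -> sub_homog h x -> sub_homog (g + h) (a *: x).
Proof. exact: gm_homogZ. Qed.

Definition sub_module : graded_module A :=
  @GradedModule G A sub_type sub_homog sub_grading sub_homogZ.

Lemma sub_val_linear : linear (val : sub_module -> M).
Proof. by []. Qed.
Definition sub_incl : ghom sub_module M :=
  @GHom sub_module M val sub_val_linear (fun g x Hx => Hx).

Lemma sub_incl_inj : injective sub_incl.
Proof. exact: val_inj. Qed.

Lemma sub_inclP (x : sub_module) : N (sub_incl x).
Proof. exact/gs_predP/(valP x). Qed.

Lemma sub_mem x : N x -> exists y, x = sub_incl y.
Proof. by move=> /gs_predP Nx; exists (Sub x Nx). Qed.

End Submodule.

Section Kernel.
Variables (M N : graded_module A) (f : ghom M N).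

Lemma kerB x y : f x = 0 -> f y = 0 -> f (x - y) = 0.
Proof. by move=> fx fy; rewrite ghomB fx fy subr0. Qed.
Lemma kerZ (a : A) x : f x = 0 -> f (a *: x) = 0.
Proof. by move=> fx; rewrite ghomZ fx scaler0. Qed.
Lemma kerH x : f x = 0 -> span (fun v => f v = 0 /\ exists g, gm_homog g v) x.
Proof.
move=> fx; have [t tE] := hcomp_sum (gm_grading M) x.
rewrite (tE (undup t)) ?undup_uniq // => [|g]; last by rewrite mem_undup.
apply: span_sum => g; apply: span_mem; split; last by exists g; apply: hcompP.
by rewrite -ghom_gcomp fx; apply: raddf0.
Qed.

Definition ker_submod : graded_submod M := @GradedSubmod G A M
  (fun x => f x = 0) (raddf0 f) kerB kerZ kerH.
Definition ker := sub_module ker_submod.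
Definition ker_incl : ghom ker M := sub_incl ker_submod.

Lemma ker_incl_inj : injective ker_incl. Proof. exact: sub_incl_inj. Qed.
Lemma ker_inclP x : f (ker_incl x) = 0. Proof. exact: (@sub_inclP M ker_submod x). Qed.
Lemma ker_mem x : f x = 0 <-> exists y, x = ker_incl y.
Proof. by split=> [/(@sub_mem M ker_submod)|[y ->]]; last exact: ker_inclP. Qed.

Lemma ker_ses : surj f -> ses ker M N.
Proof. by exists ker_incl, f; split=> //; [exact: ker_incl_inj|exact: ker_mem]. Qed.

Lemma ker_factor (L : graded_module A) (h : ghom L M) :
  (forall x, f (h x) = 0) -> exists k : ghom L ker, forall x, ker_incl (k x) = h x.
Proof.
by move=> fh; apply: ghom_factor; [exact: ker_incl_inj|move=> x; apply/ker_mem].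
Qed.

End Kernel.

Section DirectSum.
Variables M N : graded_module A.

Definition dsum_homog (g : G) (x : (M * N)%type) : Prop :=
  gm_homog g x.1 /\ gm_homog g x.2.

Lemma dsum_grading : is_grading dsum_homog.
Proof.
have MG := gm_grading M; have NG := gm_grading N.
split=> [g|g x y [Hx1 Hx2] [Hy1 Hy2]|[x y]|s f us Hf f0 g gs].
- by split; [apply: (grading0 MG)|apply: (grading0 NG)].
- by split; [apply: (gradingB MG)|apply: (gradingB NG)].
- have -> : (x, y) = (x, 0) + (0, y) by congr pair; rewrite ?addr0 ?add0r.
  apply: spanD.
    have [s Hs ->] := grading_span MG x.
    exists [seq (v, 0) | v <- s]; last first.
      rewrite big_map; elim: (s) => [|v r IHr]; rewrite ?big_nil // !big_cons -IHr.
      by congr pair; rewrite /= addr0.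
    move=> _ /mapP[v /Hs[g Hv] ->]; exists g.
    by split=> //; apply: (grading0 NG).
  have [s Hs ->] := grading_span NG y.
  exists [seq (0, v) | v <- s]; last first.
    rewrite big_map; elim: (s) => [|v r IHr]; rewrite ?big_nil // !big_cons -IHr.
    by congr pair; rewrite /= addr0.
  move=> _ /mapP[v /Hs[g Hv] ->]; exists g.
  by split=> //; apply: (grading0 MG).
- have [f1 f2] : \sum_(g <- s) (f g).1 = 0 /\ \sum_(g <- s) (f g).2 = 0.
    have := congr1 fst f0; have := congr1 snd f0.
    by rewrite !raddf_sum.
  rewrite [f g]surjective_pairing; congr pair.
    by apply: (grading_indep MG us _ f1) => // h /Hf[].
  by apply: (grading_indep NG us _ f2) => // h /Hf[].
Qed.

Lemma dsum_homogZ g h (a : A) (x : (M * N)%type) :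
  gr_homog g a -> dsum_homog h x -> dsum_homog (g + h) (a *: x).
Proof. by move=> Ha [Hx Hy]; split; apply: gm_homogZ. Qed.

Definition dsum : graded_module A :=
  @GradedModule G A (M * N)%type dsum_homog dsum_grading dsum_homogZ.

Lemma dsum_fst_linear : linear (fst : dsum -> M). Proof. by []. Qed.
Definition dsum_fst : ghom dsum M :=
  @GHom dsum M fst dsum_fst_linear (fun g x Hx => proj1 Hx).
Lemma dsum_snd_linear : linear (snd : dsum -> N). Proof. by []. Qed.
Definition dsum_snd : ghom dsum N :=
  @GHom dsum N snd dsum_snd_linear (fun g x Hx => proj2 Hx).

Lemma dsum_inl_linear : linear (fun x : M => (x, 0) : dsum).
Proof. by move=> a x y; congr pair; rewrite /= scaler0 addr0. Qed.
Definition dsum_inl : ghom M dsum :=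
  @GHom M dsum _ dsum_inl_linear (fun g x Hx => conj Hx (grading0 (gm_grading N) g)).
Lemma dsum_inr_linear : linear (fun y : N => (0, y) : dsum).
Proof. by move=> a x y; congr pair; rewrite /= scaler0 addr0. Qed.
Definition dsum_inr : ghom N dsum :=
  @GHom N dsum _ dsum_inr_linear (fun g x Hx => conj (grading0 (gm_grading M) g) Hx).

Section Copair.
Variables (L : graded_module A) (f : ghom M L) (h : ghom N L).
Lemma copair_linear : linear (fun x : dsum => f x.1 + h x.2).
Proof. by move=> a x y; rewrite !linearP scalerDr addrACA. Qed.
Lemma copair_homog g (x : dsum) : gm_homog g x -> gm_homog g (f x.1 + h x.2).
Proof.
by move=> [Hx Hy]; apply: (gradingD (gm_grading L)); apply: ghom_homog.
Qed.
Definition copair : ghom dsum L := GHom copair_linear copair_homog.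
End Copair.

Lemma dsum_ses : ses M dsum N.
Proof.
exists dsum_inl, dsum_snd; split=> [x y []//|y|x]; first by exists (0, y).
split=> [/= x2|[y ->]//]; exists x.1.
by rewrite [x]surjective_pairing x2.
Qed.

End DirectSum.
End GradedHom.
Arguments ker_incl {G A M N f} : simpl never.

(** * Regularity bounds through finite free resolutions *)

Section FreeModules.
Variables (G : zmodType) (A : graded_ring G).

Definition projective (F : graded_module A) : Prop :=
  forall (M N : graded_module A) (p : ghom M N) (f : ghom F N), surj p ->
  exists h : ghom F M, forall x, p (h x) = f x.

(** Expressions in a basis come as lists with possible repetitions, while independence speaks of
    [uniq] lists; this merges equal terms. *)
Lemma sum_count (V : lmodType A) (B : choiceType) (s t : seq B) (c : B -> A)
    (v : B -> V) : uniq t -> {subset s <= t} ->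
  \sum_(b <- s) c b *: v b = \sum_(b <- t) (c b *+ count_mem b s) *: v b.
Proof.
move=> ut; elim: s => [|i s IHs] st.
  by rewrite big_nil big1 // => b _; rewrite mulr0n scale0r.
rewrite big_cons {}IHs => [|b bs]; last by apply: st; rewrite inE bs orbT.
under [RHS]eq_bigr do rewrite /= mulrnDr scalerDl.
rewrite big_split /=; congr (_ + _).
have it : i \in t by apply: st; rewrite inE eqxx.
rewrite (bigD1_seq i) //= eqxx big1 ?addr0 // => b /negPf.
by rewrite eq_sym => ->; rewrite mulr0n scale0r.
Qed.

Section Extend.
Variables (F M : graded_module A) (B : choiceType) (deg : B -> G).
Variables (e : B -> F) (m : B -> M).
Hypothesis He : forall b, gm_homog (deg b) (e b).
Hypothesis Hm : forall b, gm_homog (deg b) (m b).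
Hypothesis gen : forall x, exists (s : seq B) (c : B -> A),
  x = \sum_(b <- s) c b *: e b.
Hypothesis indep : forall (s : seq B) (c : B -> A), uniq s ->
  \sum_(b <- s) c b *: e b = 0 -> {in s, forall b, c b = 0}.

(** Graph of the map sought. It is total by [gen], linear by [relP] and single-valued by
    [rel_inj]. *)
Let rel (x : F) (z : M) : Prop := exists (s : seq B) (c : B -> A),
  x = \sum_(b <- s) c b *: e b /\ z = \sum_(b <- s) c b *: m b.

Let relP a x y z w : rel x z -> rel y w -> rel (a *: x + y) (a *: z + w).
Proof.
move=> [s [c [-> ->]]] [r [k [-> ->]]]; pose t := undup (s ++ r).
have ut : uniq t by apply: undup_uniq.
have st : {subset s <= t} by move=> b bs; rewrite mem_undup mem_cat bs.
have rt : {subset r <= t} by move=> b bs; rewrite mem_undup mem_cat bs orbT.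
exists t, (fun b => a * (c b *+ count_mem b s) + k b *+ count_mem b r).
by rewrite !(sum_count _ _ ut st) !(sum_count _ _ ut rt) !scaler_sumr;
  split; rewrite -big_split; apply: eq_bigr => b _; rewrite scalerDl scalerA.
Qed.

Let rel_inj x z w : rel x z -> rel x w -> z = w.
Proof.
move=> xz xw; have [s [c []]] := relP (-1) xz xw.
rewrite !scaleN1r addNr addrC => /esym c0 zw; apply/esym/subr0_eq; rewrite zw.
pose t := undup s; have ut : uniq t by apply: undup_uniq.
have st : {subset s <= t} by move=> b; rewrite mem_undup.
move: c0; rewrite !(sum_count _ _ ut st) => /(indep ut) c0.
by apply: big1_seq => b /andP[_ bt]; rewrite c0 ?scale0r.
Qed.

(** Replacing each coefficient by its component of degree [g - deg b] does not change [x], hence by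
    uniqueness does not change [z] either. *)
Let rel_homog g x z : gm_homog g x -> rel x z -> gm_homog g z.
Proof.
move=> Hx xz; have [s [c [xE zE]]] := xz.
pose k b := hcomp (gr_grading A) (g - deg b) (c b).
suff /(rel_inj xz) -> : rel x (\sum_(b <- s) k b *: m b).
  apply: (grading_sum (gm_grading M)) => b _; rewrite -[g](subrK (deg b)).
  by apply: gm_homogZ => //; apply: hcompP.
exists s, k; split=> //.
rewrite -[x](hcomp_id (gm_grading F) Hx) xE raddf_sum.
apply: eq_bigr => b _; rewrite -{1}[g](subrK (deg b)).
exact: gcompZr.
Qed.

Lemma free_extend : exists f : ghom F M, forall b, f (e b) = m b.
Proof.
have /choice[f fE] x : exists z, rel x z.
  by have [s [c ->]] := gen x; exists (\sum_(b <- s) c b *: m b), s, c.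
have f_lin : linear f by move=> a x y; apply: rel_inj (fE _) (relP _ _ _).
have f_homog g x : gm_homog g x -> gm_homog g (f x).
  by move=> Hx; apply: rel_homog Hx (fE x).
exists (GHom f_lin f_homog) => b /=; apply: rel_inj (fE _) _.
by exists [:: b], (fun=> 1); rewrite !big_seq1 !scale1r.
Qed.

Lemma ghom_ext (f h : ghom F M) : (forall b, f (e b) = h (e b)) -> f =1 h.
Proof.
move=> fh x; have [s [c ->]] := gen x; rewrite !ghom_sum.
by apply: eq_bigr => b _; rewrite !ghomZ fh.
Qed.

End Extend.

End FreeModules.

Lemma graded_free_projective (A : graded_ring int) (F : graded_module A) :
  graded_free F -> projective F.
Proof.
move=> [B [deg [e [He gen indep]]]] M N p f p_surj.
have /choice[m mE] b : exists x, gm_homog (deg b) x /\ p x = f (e b).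
  have [|x Hx px] := homog_lift p_surj (g := deg b) (y := f (e b)).
    exact: ghom_homog.
  by exists x.
have [b|h hE] := free_extend He (m := m) _ gen indep; first by case: (mE b).
exists h; apply: (ghom_ext gen (f := ghom_comp p h)) => b /=.
by rewrite hE; case: (mE b).
Qed.

Section RegularityBound.
Variable A : graded_ring int.
Implicit Types (L M N F : graded_module A) (d e : int) (k : nat).

Definition cyclic_free M e (w : M) : Prop :=
  gm_homog e w /\ forall x, exists! a : A, x = a *: w.

Inductive ffree d : graded_module A -> Prop :=
| ffree_zero F : (forall x : F, x = 0) -> ffree d F
| ffree_cyclic F e (w : F) : e <= d -> cyclic_free e w -> ffree d F
| ffree_dsum F1 F2 : ffree d F1 -> ffree d F2 -> ffree d (dsum F1 F2).

Lemma ffree_le d e F : d <= e -> ffree d F -> ffree e F.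
Proof.
move=> de; elim=> {F} [F F0|F i w id Fw|F1 F2 _ F1e _ F2e].
- exact: ffree_zero.
- by apply: (@ffree_cyclic _ _ i w) => //; apply: le_trans de.
- exact: ffree_dsum.
Qed.

Lemma big_sum_pmap (V : zmodType) (B1 B2 : Type) (s : seq (B1 + B2))
    (f : B1 + B2 -> V) : (forall b, f (inr b) = 0) ->
  \sum_(b <- s) f b =
    \sum_(b <- pmap (fun b => if b is inl b1 then Some b1 else None) s) f (inl b).
Proof.
move=> f0; elim: s => [|[b|b] s IHs]; rewrite ?big_nil //= !big_cons IHs //.
by rewrite f0 add0r.
Qed.

Lemma big_sum_pmapr (V : zmodType) (B1 B2 : Type) (s : seq (B1 + B2))
    (f : B1 + B2 -> V) : (forall b, f (inl b) = 0) ->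
  \sum_(b <- s) f b =
    \sum_(b <- pmap (fun b => if b is inr b2 then Some b2 else None) s) f (inr b).
Proof.
move=> f0; elim: s => [|[b|b] s IHs]; rewrite ?big_nil //= !big_cons IHs //.
by rewrite f0 add0r.
Qed.

Lemma ffree_graded_free d F : ffree d F -> graded_free F.
Proof.
elim=> {F} [F F0|F i w _ [Hw wP]|F1 F2 _ [B1 [g1 [e1 [He1 gen1 ind1]]]] _].
- exists void, (fun b : void => match b with end), (fun b : void => match b with end).
  split=> [[]|x|s c _ _ []].
  by exists [::], (fun=> 0); rewrite big_nil [LHS]F0.
- exists unit, (fun=> i), (fun=> w); split=> [//|x|s c us].
    by have [a [-> _]] := wP x; exists [:: tt], (fun=> a); rewrite big_seq1.
  case: s us => [//|[] [|[] s]] // _; rewrite big_seq1 => cw [] _.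
  have [a [_ a_uniq]] := wP 0.
  by rewrite -(a_uniq (c tt)) ?cw // (a_uniq 0) // scale0r.
- case=> B2 [g2 [e2 [He2 gen2 ind2]]].
  pose deg b := match b with inl b1 => g1 b1 | inr b2 => g2 b2 end.
  pose e b : dsum F1 F2 := match b with inl b1 => (e1 b1, 0) | inr b2 => (0, e2 b2) end.
  exists (B1 + B2)%type, deg, e; split=> [[b|b]|[x y]|s c us c0].
  + by split; [apply: He1|apply: (grading0 (gm_grading F2))].
  + by split; [apply: (grading0 (gm_grading F1))|apply: He2].
  + have [s [c ->]] := gen1 x; have [r [k ->]] := gen2 y.
    exists ([seq inl b | b <- s] ++ [seq inr b | b <- r]).
    exists (fun b => match b with inl b1 => c b1 | inr b2 => k b2 end).
    rewrite big_cat !big_map /=.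
    have -> : \sum_(b <- s) c b *: e (inl b) =
        dsum_inl F1 F2 (\sum_(b <- s) c b *: e1 b).
      by rewrite ghom_sum; apply: eq_bigr => b _; rewrite ghomZ.
    have -> : \sum_(b <- r) k b *: e (inr b) =
        dsum_inr F1 F2 (\sum_(b <- r) k b *: e2 b).
      by rewrite ghom_sum; apply: eq_bigr => b _; rewrite ghomZ.
    by congr pair; rewrite /= ?addr0 ?add0r.
  + have [c1 c2] : \sum_(b <- s) c b *: (e b).1 = 0 /\
        \sum_(b <- s) c b *: (e b).2 = 0.
      have := congr1 (dsum_fst F1 F2) c0; have := congr1 (dsum_snd F1 F2) c0.
      by rewrite !ghom_sum.
    have linlK : ocancel (fun b : B1 + B2 => if b is inl b1 then Some b1 else None) inl.
      by case.
    have linrK : ocancel (fun b : B1 + B2 => if b is inr b2 then Some b2 else None) inr.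
      by case.
    rewrite big_sum_pmap in c1 => [|b]; last exact: scaler0.
    rewrite big_sum_pmapr in c2 => [|b]; last exact: scaler0.
    have {}c1 := ind1 _ (c \o inl) (pmap_uniq linlK us) c1.
    have {}c2 := ind2 _ (c \o inr) (pmap_uniq linrK us) c2.
    case=> b bs; [apply: c1|apply: c2]; rewrite mem_pmap.
      by apply/mapP; exists (inl b).
    by apply/mapP; exists (inr b).
Qed.

Lemma ffree_projective d F : ffree d F -> projective F.
Proof. by move=> /ffree_graded_free/graded_free_projective. Qed.

(* The first k + 1 steps of a finite free resolution of M whose i-th module is
   generated in degrees at most d + i. *)
Fixpoint reg_le k M d : Prop :=
  exists F (p : ghom F M), [/\ ffree d F, surj p &
    if k is k'.+1 then reg_le k' (ker p) (d + 1) else True].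

Lemma reg_le_gen k M d : reg_le k M d -> reg_le 0 M d.
Proof. by case: k => // k [F [p [Fd ps _]]]; exists F, p. Qed.

Lemma reg_leW k M d : reg_le k.+1 M d -> reg_le k M d.
Proof.
elim: k M d => [|k IHk] M d; first exact: reg_le_gen.
by move=> [F [p [Fd ps /IHk kp]]]; exists F, p.
Qed.

Lemma reg_le_ge k l M d : (l <= k)%N -> reg_le k M d -> reg_le l M d.
Proof.
elim: k => [|k IHk]; first by rewrite leqn0 => /eqP->.
by rewrite leq_eqVlt => /predU1P[->//|/IHk lk /reg_leW].
Qed.

Lemma reg_le_mono k M d e : d <= e -> reg_le k M d -> reg_le k M e.
Proof.
elim: k M d e => [|k IHk] M d e de [F [p [Fd ps kp]]];
  exists F, p; split=> //; try exact: ffree_le Fd.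
by apply: IHk kp; rewrite lerD2r.
Qed.

Lemma reg_le_zero k M d : (forall x : M, x = 0) -> reg_le k M d.
Proof.
elim: k M d => [|k IHk] M d M0; exists M, (ghom_id M).
  by split=> //; [apply: ffree_zero|move=> x; exists x].
split; [exact: ffree_zero|by move=> x; exists x|].
by apply: IHk => x; apply: ker_incl_inj; apply: etrans (M0 _) (esym (M0 _)).
Qed.

Lemma reg_le_ffree k F d : ffree d F -> reg_le k F d.
Proof.
move=> Fd; case: k => [|k]; exists F, (ghom_id F); split=> //; try by move=> x; exists x.
by apply: reg_le_zero => x; apply: ker_incl_inj; rewrite ghom0; apply: (ker_inclP x).
Qed.

(** Horseshoe lemma: the cover of [N] is lifted to [M] and added to that of [L], and the three
    kernels form a short exact sequence again. *)
Lemma reg_le_extension k L M N d :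
  ses L M N -> reg_le k L d -> reg_le k N d -> reg_le k M d.
Proof.
elim: k L M N d => [|k IHk] L M N d [i [p [i_inj p_surj ip]]]
    [F1 [p1 [F1d p1_surj kp1]]] [F2 [p2 [F2d p2_surj kp2]]].
all: have [q qE] := ffree_projective F2d p2 p_surj.
all: pose r := copair (ghom_comp i p1) q.
all: have r_surj : surj r by
  move=> x; have [y yE] := p2_surj (p x);
  have [|z zE] := (ip (x - q y)).1; first (by rewrite ghomB qE yE subrr);
  have [t tE] := p1_surj z; exists (t, y); rewrite /= tE -zE subrK.
all: exists (dsum F1 F2), r; split=> //; try exact: ffree_dsum.
apply: IHk kp1 kp2.
have [j jE] : exists j : ghom (ker p1) (ker r),
    forall x, ker_incl (j x) = (ker_incl x, 0).
  apply: (ker_factor (h := ghom_comp (dsum_inl F1 F2) (ker_incl (f := p1)))) => x.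
  by rewrite /= ker_inclP !ghom0 addr0.
have p20 (x : ker r) : p2 (dsum_snd F1 F2 (ker_incl x)) = 0.
  rewrite -qE; have := congr1 p (ker_inclP x); rewrite /= ghomD ghom0.
  by rewrite (ip _).2 ?add0r //; eexists.
have [h hE] : exists h : ghom (ker r) (ker p2),
    forall x, ker_incl (h x) = (ker_incl x).2.
  exact: (ker_factor (h := ghom_comp (dsum_snd F1 F2) (ker_incl (f := r)))).
exists j, h; split=> [x y xy|y|x].
- apply: ker_incl_inj.
  have := congr1 (fun z : ker r => dsum_fst F1 F2 (ker_incl z)) xy.
  by rewrite !jE.
- have [|z zE] := (ip (q (ker_incl y))).1; first by rewrite qE ker_inclP.
  have [t tE] := p1_surj z.
  have [|x xE] := (ker_mem r (- t, ker_incl y)).1.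
    by rewrite /= !ghomN tE -zE addNr.
  exists x; apply: ker_incl_inj.
  by rewrite hE -[RHS]/(dsum_snd F1 F2 (- t, ker_incl y)) xE.
- split=> [hx|[y ->]]; last by apply: ker_incl_inj; rewrite hE jE ghom0.
  have x2 : (ker_incl x).2 = 0 by rewrite -hE hx ghom0.
  have [|y yE] := (ker_mem p1 (ker_incl x).1).1.
    apply: i_inj; have := ker_inclP x.
    by rewrite /= x2 !ghom0 addr0.
  exists y; apply: ker_incl_inj; rewrite jE -yE -x2; exact: surjective_pairing.
Qed.

(** A cover [q] of [M] also covers [N], and the kernel of the composite is an extension of [L] by
    [ker q]. So [L] enters one step later, whence [l < k] and [d + 1]. *)
Lemma reg_le_quotient k L M N d : ses L M N -> reg_le k M d ->
  (forall l, (l < k)%N -> reg_le l L (d + 1)) -> reg_le k N d.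
Proof.
move=> [i [p [i_inj p_surj ip]]]; case: k => [|k] [F [q [Fd q_surj kq]]] kL.
all: have pq_surj : surj (ghom_comp p q) by
  move=> y; have [x <-] := p_surj y; have [z <-] := q_surj x; exists z.
all: exists F, (ghom_comp p q); split=> //.
apply: reg_le_extension kq (kL k (ltnSn k)).
have [j jE] : exists j : ghom (ker q) (ker (ghom_comp p q)),
    forall x, ker_incl (j x) = ker_incl x.
  by apply: (ker_factor (h := ker_incl)) => x; rewrite /= ker_inclP ghom0.
have [h hE] : exists h : ghom (ker (ghom_comp p q)) L,
    forall x, i (h x) = q (ker_incl x).
  apply: (ghom_factor (f := ghom_comp q ker_incl)) => // x.
  by apply/ip; apply: (ker_inclP x).
exists j, h; split=> [x y xy|y|x].
- by apply: ker_incl_inj; rewrite -!jE xy.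
- have [z zE] := q_surj (i y).
  have [|x xE] := (ker_mem (ghom_comp p q) z).1; first by apply/ip; exists y.
  by exists x; apply: i_inj; rewrite hE -xE zE.
- split=> [hx|[y ->]]; last by apply: i_inj; rewrite hE jE ker_inclP ghom0.
  have [|y yE] := (ker_mem q (ker_incl x)).1; first by rewrite -hE hx ghom0.
  by exists y; apply: ker_incl_inj; rewrite jE.
Qed.

(** [ker p] is itself a retract of [M], through x - i (p x), so that the induction bounds it with
    one step less; [N] is the quotient of [M] by it. *)
Lemma reg_le_retract k M N d (i : ghom N M) (p : ghom M N) :
  cancel i p -> reg_le k M d -> reg_le k N d.
Proof.
elim: k M N d i p => [|k IHk] M N d i p ipK kM.
all: have p_surj : surj p by move=> y; exists (i y).
all: apply: (reg_le_quotient (ker_ses p_surj) kM) => l lk.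
  by [].
apply: (@reg_le_ge k l _ _ lk); apply: (@reg_le_mono _ _ d); first by rewrite lerDl.
have [h hE] : exists h : ghom M (ker p), forall x, ker_incl (h x) = x - i (p x).
  apply: (ker_factor (h := ghom_sub (ghom_id M) (ghom_comp i p))) => x.
  by rewrite /= ghomB ipK subrr.
apply: (IHk _ _ _ (ker_incl (f := p)) h); last exact: reg_leW.
by move=> x; apply: ker_incl_inj; rewrite hE ker_inclP ghom0 subr0.
Qed.

(* The pullback [E] of [M -> N] along a free cover [F -> N] is an extension of
   [M] by the first syzygy of [N], and [L] is a direct summand of [E]. *)
Lemma reg_le_kernel k L M N d : ses L M N -> reg_le k M d ->
  reg_le k.+1 N (d - 1) -> reg_le k L d.
Proof.
move=> [i [p [i_inj p_surj ip]]] kM [F [q [Fd q_surj kq]]].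
rewrite subrK in kq.
pose r := copair p (ghom_sub (ghom_0 F N) q).
have rE x : r x = p x.1 - q x.2 by rewrite /= sub0r.
(* The pullback is [ker r]. With this lift of [q] through [p], the map (x, y) -> x - s y retracts it
   onto [L]. *)
have [s sE] := ffree_projective Fd q p_surj.
have kE : reg_le k (ker r) d.
  apply: reg_le_extension kq kM.
  have [j jE] : exists j : ghom (ker q) (ker r),
      forall x, ker_incl (j x) = (0, ker_incl x).
    apply: (ker_factor (h := ghom_comp (dsum_inr M F) ker_incl)) => x.
    by rewrite rE /= ghom0 ker_inclP subrr.
  pose f : ghom (ker r) M := ghom_comp (dsum_fst M F) ker_incl.
  have fE x : f x = (ker_incl x).1 by [].
  exists j, f; split=> [x y xy|y|x].
  - apply: ker_incl_inj.
    have := congr1 (fun z : ker r => dsum_snd M F (ker_incl z)) xy.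
    by rewrite !jE.
  - have [z zE] := q_surj (p y).
    have [|x xE] := (ker_mem r (y, z)).1; first by rewrite rE /= zE subrr.
    by exists x; rewrite fE -xE.
  - rewrite fE; split=> [x1|[y ->]]; last by rewrite jE.
    have := ker_inclP x; rewrite rE x1 ghom0 sub0r => /eqP.
    rewrite oppr_eq0 => /eqP /ker_mem[y yE]; exists y; apply: ker_incl_inj.
    by rewrite jE -yE -x1; apply: surjective_pairing.
have [j jE] : exists j : ghom L (ker r), forall x, ker_incl (j x) = (i x, 0).
  apply: (ker_factor (h := ghom_comp (dsum_inl M F) i)) => x.
  by rewrite rE /= ghom0 subr0; apply/ip; exists x.
have [h hE] : exists h : ghom (ker r) L,
    forall x, i (h x) = (ker_incl x).1 - s (ker_incl x).2.
  pose f := ghom_sub (dsum_fst M F) (ghom_comp s (dsum_snd M F)).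
  apply: (ghom_factor (f := ghom_comp f ker_incl)) => // x.
  by apply/ip; rewrite /= ghomB sE -rE ker_inclP.
apply: (reg_le_retract (i := j) (p := h)) kE => x.
by apply: i_inj; rewrite hE jE /= ghom0 subr0.
Qed.

(** The terms need not be free: [ker p] is resolved by the tail of the complex, with [d] raised and
    [k] lowered by 1, and [M] is a quotient of [C 0]. This is why [C i] is needed for [k - i] steps
    only. *)
Lemma reg_le_resolution k (C : nat -> graded_module A)
    (D : forall i, ghom (C i.+1) (C i)) M (p : ghom (C 0%N) M) d :
  surj p -> (forall x, p x = 0 <-> exists y, x = D 0%N y) ->
  (forall i x, D i x = 0 <-> exists y, x = D i.+1 y) ->
  (forall i, (i <= k)%N -> reg_le (k - i) (C i) (d + i%:Z)) -> reg_le k M d.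
Proof.
elim: k C D M p d => [|k IHk] C D M p d p_surj pD DD kC.
all: have := kC 0%N (leq0n _); rewrite subn0 addr0 => kC0.
all: apply: (reg_le_quotient (ker_ses p_surj)) kC0 _ => l lk.
  by [].
apply: (@reg_le_ge k l _ _ lk).
have [q qE] : exists q : ghom (C 1%N) (ker p), forall x, ker_incl (q x) = D 0%N x.
  by apply: ker_factor => x; apply/pD; exists x.
apply: (IHk (fun i => C i.+1) (fun i => D i.+1) _ q).
- move=> y; have [|x xE] := (pD (ker_incl y)).1; first exact: ker_inclP.
  by exists x; apply: ker_incl_inj; rewrite qE.
- move=> x; split=> [qx|xD].
    by apply/DD; rewrite -qE qx ghom0.
  by apply: ker_incl_inj; rewrite qE ghom0; apply/DD.
- by [].
- by move=> i ik; rewrite -addrA -PoszD; apply: (kC i.+1).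
Qed.

End RegularityBound.

(** * From resolutions to Tor *)

Section TorBound.
Variable A : graded_ring int.
Implicit Types (L M N F : graded_module A) (d e j : int) (k : nat).

Lemma irr_mul_map M N (f : ghom M N) x : irr_mul x -> irr_mul (f x).
Proof.
apply: (span_map (f := f)) => _ [i [a [v [i0 Ha ->]]]]; apply: span_mem.
by exists i, a, (f v); split=> //; apply: ghomZ.
Qed.

Lemma irr_mul_lift M N (f : ghom M N) y : surj f -> irr_mul y ->
  exists2 x, irr_mul x & f x = y.
Proof.
move=> f_surj; elim/span_ind: y / => [|y z [u Iu <-] [v Iv <-]|y].
- by exists 0; [apply: span0|apply: ghom0].
- by exists (u + v); [apply: spanD|apply: ghomD].
- move=> [i [a [v [i0 Ha ->]]]]; have [u <-] := f_surj v.
  by exists (a *: u); [apply: span_mem; exists i, a, u|apply: ghomZ].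
Qed.

(** The coefficients on basis elements of degree at most [d] can be taken of positive degree. *)
Lemma ffree_irr_mul d F j (x : F) : ffree d F -> d < j -> gm_homog j x -> irr_mul x.
Proof.
move=> Fd dj; elim: Fd x => {F} [F F0 x _|F e w ed [Hw wP] x Hx|].
- by rewrite (F0 x); apply: span0.
- have [a [xE _]] := wP x; apply: span_mem.
  exists (j - e), (hcomp (gr_grading A) (j - e) a), w; split.
  + by rewrite subr_gt0; apply: le_lt_trans dj.
  + exact: hcompP.
  + by rewrite -(gcompZr (j - e) a Hw) subrK -xE hcomp_id.
- move=> F1 F2 _ IH1 _ IH2 [x y] [/= Hx Hy].
  have -> : (x, y) = dsum_inl F1 F2 x + dsum_inr F1 F2 y.
    by congr pair; rewrite /= ?addr0 ?add0r.
  apply: spanD; first by apply: (irr_mul_map (dsum_inl F1 F2)); apply: IH1.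
  by apply: (irr_mul_map (dsum_inr F1 F2)); apply: IH2.
Qed.

Lemma reg_le_irr_mul k M d j (x : M) :
  reg_le k M d -> d < j -> gm_homog j x -> irr_mul x.
Proof.
move=> /reg_le_gen [F [p [Fd p_surj _]]] dj /(homog_lift p_surj)[y Hy <-].
exact/irr_mul_map/(ffree_irr_mul Fd dj Hy).
Qed.

Section ResolutionMaps.
Variables (M : graded_module A) (F : free_resolution M).

Definition res_aug_hom : ghom (res_mod F 0) M :=
  GHom (linearP (res_aug F)) (@res_aug_homog _ _ F).
Definition res_d_hom i : ghom (res_mod F i.+1) (res_mod F i) :=
  GHom (linearP (res_d F i)) (@res_d_homog _ _ F i).

Lemma res_projective i : projective (res_mod F i).
Proof. exact/graded_free_projective/res_free. Qed.

End ResolutionMaps.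

(** Tor_0 is M / A_+ M, and [M] is generated in degrees at most [d]. *)
Lemma tor0_bound M d (F : free_resolution M) j (x : res_mod F 0) :
  reg_le 0 M d -> d < j -> gm_homog j x -> res_boundary x.
Proof.
move=> kM dj Hx.
have /(irr_mul_lift (@res_aug_surj _ _ F : surj (res_aug_hom F)))[z Iz zE] :
  irr_mul (res_aug_hom F x) by apply: reg_le_irr_mul kM dj _; apply: ghom_homog.
have /res_exact0[y yE] : res_aug F (x - z) = 0.
  by rewrite raddfB; apply/eqP; rewrite subr_eq0; apply/eqP.
by exists y; rewrite -yE subKr.
Qed.

(* The resolution [F] need not be minimal, so that its syzygies are not bounded
   by [d]; they are however retracts of the syzygies of [M'] up to maps which
   factor through a projective module, and positive Tor does not see those. *)
Lemma tor_bound k : forall M M' P d (f : ghom M M') (g : ghom M' M)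
    (u : ghom M P) (v : ghom P M) (F : free_resolution M) j (x : res_mod F k.+1),
  projective P -> (forall x, g (f x) - x = v (u x)) -> reg_le k.+1 M' d ->
  d + k.+1%:Z < j -> gm_homog j x -> res_cycle x -> res_boundary x.
Proof.
elim: k => [|k IHk] M M' P d f g u v F j x Pproj fgE [Q [q [Qd q_surj kq]]] dj Hx xc.
all: have [aug augE] : exists a : ghom (res_mod F 0) M, forall z, a z = res_aug F z
  by exists (res_aug_hom F).
all: have aug_surj : surj aug by
  move=> y; have [z zE] := res_aug_surj F y; exists z; rewrite augE.
all: have [c cE] := (res_projective (F := F) (i := 0)) _ _ q (ghom_comp f aug) q_surj.
all: have [h hE] := ffree_projective Qd (ghom_comp g q) aug_surj.
all: have [s sE] := Pproj _ _ _ v aug_surj.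
(* The lifts make [h \o c] equal to the identity up to [s \o u \o aug] and an error [e] with values
   in the first syzygy. On [ker aug] the term with [aug] vanishes, so [r \o t] minus the identity
   factors through [res_mod F 0], which replaces [P] in the induction. *)
all: have [e eE] : exists e : ghom (res_mod F 0) (ker aug), forall z,
    ker_incl (e z) = h (c z) - z - s (u (aug z)) by
  apply: (ker_factor (h := ghom_sub (ghom_sub (ghom_comp h c) (ghom_id _))
    (ghom_comp s (ghom_comp u aug)))) => z;
  rewrite /= !ghomB hE /= cE /= sE -fgE subrr.
all: have [r rE] : exists r : ghom (ker q) (ker aug), forall z,
    ker_incl (r z) = h (ker_incl z) by
  apply: (ker_factor (h := ghom_comp h ker_incl)) => z;
  rewrite /= hE /= ker_inclP ghom0.
all: have [t tE] : exists t : ghom (ker aug) (ker q), forall z,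
    ker_incl (t z) = c (ker_incl z) by
  apply: (ker_factor (h := ghom_comp c ker_incl)) => z;
  rewrite /= cE /= ker_inclP ghom0.
all: have rtE z : r (t z) - z = e (ker_incl z) by
  apply: ker_incl_inj; rewrite ghomB rE tE eE ker_inclP !ghom0 subr0.
all: have [p pE] : exists p : ghom (res_mod F 1) (ker aug), forall z,
    ker_incl (p z) = res_d F 0 z by
  apply: (ker_factor (h := res_d_hom F 0)) => z; rewrite augE; apply/res_exact0; exists z.
all: have p_surj : surj p by
  move=> y; have := ker_inclP y; rewrite augE => /res_exact0[z zE];
  exists z; apply: ker_incl_inj; rewrite pE zE.
(* Both terms come from A_+: [t (p x)] because [ker q] is generated in degrees at most d + 1 < j,
   and [ker_incl (p x)], the differential of [x], because [x] is a cycle. *)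
- have Ipx : irr_mul (p x).
    have -> : p x = r (t (p x)) - e (ker_incl (p x)) by rewrite -rtE subKr.
    apply: irr_mulB; apply: irr_mul_map; last by rewrite pE.
    by apply: (@reg_le_irr_mul 0 _ (d + 1) j _ kq dj); do 2!apply: ghom_homog.
  have [z Iz zE] := irr_mul_lift p_surj Ipx.
  have /res_exact[y yE] : res_d F 0 (x - z) = 0.
    have -> : res_d F 0 (x - z) = res_d F 0 x - res_d F 0 z.
      exact: (ghomB (res_d_hom F 0)).
    by rewrite -!pE zE subrr.
  by exists y; rewrite -yE subKr.
- pose p_lin : {linear res_mod F 1 -> ker aug} := p.
  have p0 z : p_lin z = 0 <-> exists y, z = res_d F 1 y.
    rewrite -res_exact; split=> [pz|dz]; first by rewrite -pE [p z]pz ghom0.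
    by apply: ker_incl_inj; rewrite pE dz ghom0.
  (* Deleting [res_mod F 0] leaves a resolution of [ker aug], with the same cycles and boundaries
     one index lower in positive homological degrees. *)
  pose F' := @FreeResolution _ (ker aug) (fun i => res_mod F i.+1)
    (fun i => res_d F i.+1) p_lin (fun i => res_free F i.+1)
    (fun i => @res_d_homog _ _ F i.+1) (@ghom_homog _ _ _ _ p) p_surj p0
    (fun i => @res_exact _ _ F i.+1).
  apply: (IHk _ _ _ (d + 1) t r ker_incl e F' j x) => //.
  + exact: res_projective.
  + by rewrite -addrA -PoszD add1n.
Qed.

Lemma Tor_neq0_bound M d i j :
  (forall k, reg_le k M d) -> Tor_neq0 M i j -> j - i%:Z <= d.
Proof.
move=> kM [F [x [Hx xc xb]]]; rewrite lerBlDr leNgt; apply/negP => dj.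
case: i => [|i] in x Hx xc xb dj *.
  by apply: xb; apply: tor0_bound (kM 0%N) _ Hx; rewrite addr0 in dj.
apply: xb; have [P P0 M0] : exists2 P : graded_module A, projective P & True.
  by exists (ker (ghom_id M)) => //; apply/(@ffree_projective _ 0)/ffree_zero => y;
    apply: ker_incl_inj; rewrite ghom0; apply: (ker_inclP y).
apply: (tor_bound (f := ghom_id M) (g := ghom_id M) (u := ghom_0 M P)
  (v := ghom_0 P M) P0 _ (kM i.+1) dj Hx xc) => y.
by rewrite /= subrr.
Qed.

Record stage := Stage {
  stage_mod : graded_module A;
  stage_deg : int;
  stage_reg : forall k, reg_le k stage_mod stage_deg }.

(** The cover given by [reg_le k] may change with [k]. The one for k = 0 is kept, and
    [reg_le_kernel] bounds its kernel for all [k] at once, so that the construction can be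
    iterated. *)
Lemma stage_cover (s : stage) : exists (F : graded_module A),
  exists p : ghom F (stage_mod s), [/\ ffree (stage_deg s) F, surj p
    & forall k, reg_le k (ker p) (stage_deg s + 1)].
Proof.
have [F [p [Fd p_surj _]]] := stage_reg s 0.
exists F, p; split=> // k; apply: reg_le_kernel (ker_ses p_surj) _ _.
  by apply: reg_le_ffree; apply: ffree_le Fd; rewrite lerDl.
by rewrite addrK; apply: stage_reg.
Qed.

Let cover s : graded_module A := projT1 (cid (stage_cover s)).
Let cover_map s : ghom (cover s) (stage_mod s) :=
  projT1 (cid (projT2 (cid (stage_cover s)))).
Let cover_mapP s : [/\ ffree (stage_deg s) (cover s), surj (cover_map s)
    & forall k, reg_le k (ker (cover_map s)) (stage_deg s + 1)] :=
  projT2 (cid (projT2 (cid (stage_cover s)))).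
Let next s : stage :=
  @Stage (ker (cover_map s)) (stage_deg s + 1) (let: And3 _ _ kp := cover_mapP s in kp).

(** For the lower bound: [Tor_neq0] asks for one infinite resolution, whereas the [reg_le k] only
    give finite pieces that need not be compatible. *)
Lemma free_resolution_exists M d : (forall k, reg_le k M d) ->
  inhabited (free_resolution M).
Proof.
move=> kM; pose st i := iter i next (Stage kM).
have p_surj s : surj (cover_map s) by case: (cover_mapP s).
pose D i : ghom (cover (st i.+1)) (cover (st i)) :=
  ghom_comp (ker_incl (f := cover_map (st i))) (cover_map (st i.+1)).
have D_im i x : cover_map (st i) x = 0 <-> exists y, x = D i y.
  rewrite ker_mem; split=> [[y ->]|[y ->]]; last by exists (cover_map (st i.+1) y).
  by have [z <-] := p_surj (st i.+1) y; exists z.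
split; apply: (@FreeResolution _ M (fun i => cover (st i)) D (cover_map (st 0))).
- by move=> i; case: (cover_mapP (st i)) => /ffree_graded_free.
- by move=> i j x; apply: (ghom_homog (D i)).
- by move=> j x; apply: (ghom_homog (cover_map (st 0))).
- exact: (p_surj (st 0)).
- exact: (D_im 0).
- move=> i x; rewrite -(D_im i.+1); split=> [Dx|x0].
    by apply: ker_incl_inj; rewrite ghom0.
  by apply: etrans (ghom0 ker_incl); congr (ker_incl _).
Qed.

(** In degree [d], only the component of [v] of degree d - i < d contributes to a product [a *: v]
    with [a] of degree i > 0, and it vanishes. *)
Lemma irr_mul_bottom M d (x : M) :
  (forall j (y : M), j < d -> gm_homog j y -> y = 0) ->
  gm_homog d x -> irr_mul x -> x = 0.
Proof.
move=> M0 Hx Ix; rewrite -(hcomp_id (gm_grading M) Hx).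
elim/span_ind: x / Ix {Hx} => [|x y x0 y0|_ [i [a [v [i0 Ha ->]]]]].
- exact: raddf0.
- by rewrite raddfD /= x0 y0 addr0.
- have v0 : gcomp (- i + d) v = 0.
    by apply: M0 (hcompP _ _ _); rewrite gtrDr oppr_lt0.
  by rewrite -[d](addNKr i) (gcompZ _ _ Ha) v0 scaler0.
Qed.

(** A cover has basis elements in degrees at most [d], and those of smaller degree are sent to
    zero. *)
Lemma generated_in_bottom_degree M d : reg_le 0 M d ->
  (forall j (y : M), j < d -> gm_homog j y -> y = 0) -> generated_in_degree M d.
Proof.
move=> [F [p [Fd p_surj _]]] M0 y; have [x <-] := p_surj y.
elim: Fd p {p_surj} x => {F} [F F0 p x|F e w ed [Hw wP] p x|F1 F2 _ IH1 _ IH2 p x].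
- by rewrite (F0 x) ghom0; apply: span0.
- have [a [-> _]] := wP x; rewrite ghomZ.
  have Hpw := ghom_homog p Hw.
  move: ed; rewrite le_eqVlt => /predU1P[ed|/M0 pw].
    by apply: span_mem; exists a, (p w); rewrite -ed.
  by rewrite (pw _ Hpw) scaler0; apply: span0.
- have -> : p x = ghom_comp p (dsum_inl F1 F2) x.1
      + ghom_comp p (dsum_inr F1 F2) x.2.
    rewrite /= -ghomD; congr (p _); rewrite [LHS]surjective_pairing.
    by congr pair; rewrite /= ?addr0 ?add0r.
  by apply: spanD.
Qed.

(** The upper bound is [Tor_neq0_bound]. It is attained by Tor_0, as a non-zero element of lowest
    degree cannot lie in A_+ M. *)
Lemma reg_eq M d (y : M) : (forall k, reg_le k M d) ->
  (forall j (y : M), j < d -> gm_homog j y -> y = 0) ->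
  gm_homog d y -> y <> 0 -> reg M = d%:E.
Proof.
move=> kM M0 Hy y0; have [F] := free_resolution_exists kM.
have [x Hx xE] : exists2 x : res_mod F 0, gm_homog d x & res_aug_hom F x = y.
  by apply: homog_lift Hy; apply: res_aug_surj.
rewrite /reg; set S := (X in supremum _ X).
have Sd : S d%:E.
  exists 0%N, d; split; last by rewrite subr0.
  exists F, x; split=> // -[z /(irr_mul_map (res_aug_hom F)) Iz].
  apply: y0; apply: irr_mul_bottom M0 Hy _.
  have dz : res_aug_hom F (res_d F 0 z) = 0 by apply/res_exact0; exists z.
  by move: Iz; rewrite ghomB xE dz subr0.
have S_le z : S z -> (z <= d%:E)%O.
  by move=> [i [j [/(Tor_neq0_bound kM) ij ->]]]; rewrite lee_fin.
have S_sup : supremums S d%:E by split=> // z; apply.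
rewrite /supremum ifN; last by apply/set0P; exists d%:E.
case: xgetP => [z _ zs|/(_ _ S_sup)//]; exact: is_subset1_supremums zs S_sup.
Qed.

End TorBound.

(** * Change of rings *)

Section CyclicFree.
Variable A : graded_ring int.
Implicit Types M N : graded_module A.

Lemma cyclic_free_hom M N e (w : M) (n : N) : cyclic_free e w ->
  gm_homog e n -> exists f : ghom M N, f w = n.
Proof.
move=> [Hw wP] Hn.
have [x|s c us|f fw] := @free_extend _ _ M N unit (fun=> e) (fun=> w) (fun=> n)
    (fun=> Hw) (fun=> Hn).
- have [a [-> _]] := wP x.
  by exists [:: tt], (fun=> a); rewrite big_seq1.
- case: s us => [//|[] [|[] s]] // _; rewrite big_seq1 => cw [] _.
  have [a [_ a_uniq]] := wP 0.
  by rewrite -(a_uniq (c tt)) ?cw // (a_uniq 0) // scale0r.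
- by exists f; apply: (fw tt).
Qed.

Lemma cyclic_free_iso M N e (w : M) (n : N) :
  cyclic_free e w -> cyclic_free e n ->
  exists (f : ghom M N) (g : ghom N M), cancel f g.
Proof.
move=> Fw Fn; have [f fw] := cyclic_free_hom Fw (proj1 Fn).
have [g gn] := cyclic_free_hom Fn (proj1 Fw).
exists f, g => x; have [a [-> _]] := proj2 Fw x.
by rewrite !ghomZ fw gn.
Qed.

End CyclicFree.

Section Restriction.
Variables (B A : graded_ring int) (phi : {rmorphism B -> A}).
Hypothesis phi_homog : forall i b, gr_homog i b -> gr_homog i (phi b).

(** The argument [f] records in the type the morphism along which scalars are restricted, so that
    the [B]-module structure can be attached to it. *)
Definition restr_type (f : {rmorphism B -> A}) (M : graded_module A) : Type := M.

Section Module.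
Variable M : graded_module A.
HB.instance Definition _ := GRing.Zmodule.on (restr_type phi M).

Definition restr_scale (b : B) (x : restr_type phi M) : restr_type phi M :=
  phi b *: (x : M).
Fact restr_scaleA a b x : restr_scale a (restr_scale b x) = restr_scale (a * b) x.
Proof. by rewrite /restr_scale scalerA rmorphM. Qed.
Fact restr_scale1 : left_id 1 restr_scale.
Proof. by move=> x; rewrite /restr_scale rmorph1 scale1r. Qed.
Fact restr_scaleDr : right_distributive restr_scale +%R.
Proof. by move=> a x y; apply: scalerDr. Qed.
Fact restr_scaleDl x : {morph restr_scale^~ x : a b / a + b}.
Proof. by move=> a b; rewrite /restr_scale rmorphD; apply: scalerDl. Qed.
HB.instance Definition _ := GRing.Zmodule_isLmodule.Build B (restr_type phi M)
  restr_scaleA restr_scale1 restr_scaleDr restr_scaleDl.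

Definition restr_homog (i : int) (x : restr_type phi M) : Prop :=
  @gm_homog _ _ M i x.
Lemma restr_homogZ g h (b : B) (x : restr_type phi M) :
  gr_homog g b -> restr_homog h x -> restr_homog (g + h) (b *: x).
Proof. by move=> /phi_homog Hb; apply: gm_homogZ. Qed.

Definition restr : graded_module B :=
  @GradedModule int B (restr_type phi M) restr_homog (gm_grading M) restr_homogZ.
End Module.

Section Hom.
Variables (M N : graded_module A) (f : ghom M N).
Lemma restr_hom_linear : linear (f : restr M -> restr N).
Proof. by move=> b x y; apply: (ghom_linear f). Qed.
Definition restr_hom : ghom (restr M) (restr N) :=
  @GHom _ B (restr M) (restr N) f restr_hom_linear (@ghom_homog _ _ _ _ f).
End Hom.

Lemma restr_ses L M N : ses L M N -> ses (restr L) (restr M) (restr N).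
Proof. by move=> [i [p H]]; exists (restr_hom i), (restr_hom p). Qed.

(* U is a copy of A(-e). *)
Hypothesis restr_free : forall e : int, exists (U : graded_module A) (w : U),
  cyclic_free e w /\ forall k, reg_le k (restr U) (e + 1).

Lemma restr_ffree k d (F : graded_module A) : ffree d F -> reg_le k (restr F) (d + 1).
Proof.
elim=> {F} [F F0|F e w ed Fw|F1 F2 _ IH1 _ IH2].
- exact: reg_le_zero.
- have [U [z [Fz kU]]] := restr_free e.
  have [f [g fgK]] := cyclic_free_iso Fw Fz.
  apply: (reg_le_retract (i := restr_hom f) (p := restr_hom g)) => //.
  by apply: reg_le_mono (kU k); rewrite lerD2r.
- exact: reg_le_extension (restr_ses (dsum_ses F1 F2)) IH1 IH2.
Qed.

(** [F'] stands for the base change of [F] to [A], built summand by summand; generators keep their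
    degrees. *)
Lemma restr_cover d (F : graded_module B) M (p : ghom F (restr M)) : ffree d F ->
  exists (F' : graded_module A) (q : ghom F' M),
    ffree d F' /\ forall x, exists y, q y = p x.
Proof.
move=> Fd; elim: Fd p => {F} [F F0 p|F e w ed [Hw wP] p|F1 F2 _ IH1 _ IH2 p].
- exists (ker (ghom_id M)), (ghom_0 _ _); split=> [|x].
    apply: ffree_zero => y; apply: ker_incl_inj.
    by rewrite ghom0; apply: (ker_inclP y).
  by exists 0; rewrite (F0 x) !ghom0.
- have [U [z [Fz _]]] := restr_free e.
  have [q qz] := cyclic_free_hom (N := M) Fz (ghom_homog p Hw).
  exists U, q; split=> [|x]; first exact: ffree_cyclic Fz.
  have [b [-> _]] := wP x; exists (phi b *: z).
  by rewrite !ghomZ qz.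
- have [G1 [q1 [G1d qE1]]] := IH1 (ghom_comp p (dsum_inl F1 F2)).
  have [G2 [q2 [G2d qE2]]] := IH2 (ghom_comp p (dsum_inr F1 F2)).
  exists (dsum G1 G2), (copair q1 q2); split=> [|[x y]]; first exact: ffree_dsum.
  have [u uE] := qE1 x; have [v vE] := qE2 y; exists (u, v).
  have -> : (x, y) = dsum_inl F1 F2 x + dsum_inr F1 F2 y.
    by congr pair; rewrite /= ?addr0 ?add0r.
  by rewrite (ghomD p) /= uE vE.
Qed.

(** Over [B] an [A]-free cover has regularity at most d + 1, since [A] has regularity at most 1;
    hence so has its kernel. This is just the bound required of a first syzygy, so the induction
    closes. *)
Lemma reg_le_change_of_rings k M d :
  (forall l, reg_le l (restr M) d) -> reg_le k M d.
Proof.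
elim: k M d => [|k IHk] M d lM.
all: have [F [p [Fd p_surj _]]] := lM 0%N.
all: have [F' [q [F'd qE]]] := restr_cover p Fd.
all: have q_surj : surj q by
  move=> y; have [x <-] := p_surj y; apply: qE.
all: exists F', q; split=> //.
apply: IHk => l; apply: reg_le_kernel (restr_ses (ker_ses q_surj)) _ _.
  exact: restr_ffree.
by rewrite addrK.
Qed.

End Restriction.

(** * Koszul complexes *)

(* [ksz k i] is the binomial coefficient 'C(k, i), defined so that
   [ksz k.+1 i.+1] and [ksz k 0] reduce for arbitrary [k] and [i]. *)
Fixpoint sz (k i : nat) : nat :=
  if k is k'.+1 then (sz k' i + (if i is i'.+1 then sz k' i' else 1))%N else 0%N.
Definition ksz (k i : nat) : nat := if i is i'.+1 then sz k i' else 1%N.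

Section KoszulMatrices.
Variables (R : comPzRingType) (y : nat -> R).

(* The differential K_{i+1} -> K_i of the Koszul complex of y_0, ..., y_{k-1},
   acting on row vectors: K(y_0, ..., y_k) is the cone of multiplication by
   y_k on K(y_0, ..., y_{k-1}). *)
Fixpoint kmx (k : nat) : forall i, 'M[R]_(ksz k i.+1, ksz k i) :=
  match k with
  | 0%N => fun i => 0
  | k'.+1 => fun i => match i with
    | 0%N => col_mx (kmx k' 0%N) (y k')%:M
    | i'.+1 => block_mx (kmx k' i'.+1) 0 (y k')%:M (- kmx k' i')
    end
  end.

Lemma mul_row_kmx0 k (u : 'rV[R]_(ksz k 1)) (v : 'rV[R]_(ksz k 0)) :
  row_mx u v *m kmx k.+1 0 = u *m kmx k 0 + y k *: v.
Proof.
transitivity (u *m kmx k 0 + v *m (y k)%:M); first exact: mul_row_col.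
by rewrite mul_mx_scalar.
Qed.

Lemma mul_row_kmxS k i (u : 'rV[R]_(ksz k i.+2)) (v : 'rV[R]_(ksz k i.+1)) :
  row_mx u v *m kmx k.+1 i.+1
    = row_mx (u *m kmx k i.+1 + y k *: v) (- (v *m kmx k i)).
Proof.
transitivity (row_mx (u *m kmx k i.+1 + v *m (y k)%:M) (u *m 0 + v *m - kmx k i)).
  exact: mul_row_block.
by rewrite mul_mx_scalar mulmx0 add0r mulmxN.
Qed.

Lemma mulmx_kmx_kmx k i (v : 'rV[R]_(ksz k i.+2)) : v *m kmx k i.+1 *m kmx k i = 0.
Proof.
elim: k i v => [|k IHk] i v; first exact: mulmx0.
rewrite -[v](hsubmxK (n1 := ksz k i.+2) (n2 := ksz k i.+1)) mul_row_kmxS.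
move: (lsubmx _) (rsubmx _) => a b; case: i a b {v} => [|i] a b.
  by rewrite mul_row_kmx0 mulmxDl IHk add0r -scalemxAl scalerN subrr.
rewrite mul_row_kmxS mulmxDl IHk add0r -scalemxAl scalerN subrr.
by rewrite mulNmx IHk oppr0 oppr0 row_mx0.
Qed.

Definition kexact k i (v : 'rV[R]_(ksz k i)) : Prop := exists w, v = w *m kmx k i.

(** The hypothesis says that y_j is regular modulo its predecessors. By induction, a cycle (a, b) of
    the cone is a boundary as soon as [b] is one. For [i] positive, [b] is a cycle of the smaller
    complex; for [i = 0] only y_k b is known to be a boundary, and regularity concludes. *)
Lemma kmx_exact k :
  (forall j, (j < k)%N -> forall v : 'rV[R]_(ksz j 0), kexact (y j *: v) -> kexact v) ->
  forall i (v : 'rV[R]_(ksz k i.+1)), v *m kmx k i = 0 -> kexact v.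
Proof.
elim: k => [|k IHk] yreg i v.
  by move=> _; exists 0; rewrite mul0mx; apply: thinmx0.
have {}IHk := IHk (fun j jk => yreg j (ltnW jk)).
rewrite -[v](hsubmxK (n1 := ksz k i.+1) (n2 := ksz k i)).
move: (lsubmx _) (rsubmx _) => a b ab0.
have [ab [w bE]] : a *m kmx k i + y k *: b = 0 /\ kexact b.
  case: i a b ab0 {v} => [|i] a b.
    rewrite mul_row_kmx0 => ab0; split=> //; apply: yreg => //.
    by exists (- a); rewrite mulNmx; apply/eqP; rewrite -addr_eq0 addrC ab0.
  rewrite mul_row_kmxS -[0]row_mx0 => /eq_row_mx[ab0 b0]; split=> //.
  by apply: IHk; apply/eqP; rewrite -oppr_eq0 b0.
have /IHk[u uE] : (a + y k *: w) *m kmx k i = 0.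
  by rewrite mulmxDl -scalemxAl -bE.
exists (row_mx u (- w)); rewrite mul_row_kmxS -uE scalerN addrK.
by rewrite mulNmx opprK -bE.
Qed.

End KoszulMatrices.

Lemma map_kmx (R R' : comPzRingType) (phi : {rmorphism R -> R'}) (y : nat -> R) k i :
  map_mx phi (kmx y k i) = kmx (phi \o y) k i.
Proof.
elim: k i => [|k IHk] i; first exact: map_mx0.
case: i => [|i].
  transitivity (col_mx (map_mx phi (kmx y k 0)) (map_mx phi (y k)%:M)).
    exact: map_col_mx.
  by rewrite IHk map_scalar_mx.
transitivity (block_mx (map_mx phi (kmx y k i.+1)) (map_mx phi 0)
    (map_mx phi (y k)%:M) (map_mx phi (- kmx y k i))).
  exact: map_block_mx.
by rewrite map_mx0 map_mxN !IHk map_scalar_mx.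
Qed.

Section HomogeneousRows.
Variables (G : zmodType) (R : graded_ring G).

Definition row_homog n (g : G) (v : 'rV[R]_n) : Prop := forall j, gr_homog g (v 0 j).

Lemma row_homog_mx n p g (a : 'rV[R]_n) (b : 'rV[R]_p) :
  row_homog g (row_mx a b) <-> row_homog g a /\ row_homog g b.
Proof.
split=> [Hab|[Ha Hb] j]; last first.
  by rewrite -(splitK j); case: (split j) => l /=; rewrite ?row_mxEl ?row_mxEr.
split=> j; first by have := Hab (lshift p j); rewrite row_mxEl.
by have := Hab (rshift n j); rewrite row_mxEr.
Qed.

Lemma row_homogD n g (a b : 'rV[R]_n) :
  row_homog g a -> row_homog g b -> row_homog g (a + b).
Proof. by move=> Ha Hb j; rewrite mxE; apply: (gradingD (gr_grading R)). Qed.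

Lemma row_homogN n g (a : 'rV[R]_n) : row_homog g a -> row_homog g (- a).
Proof. by move=> Ha j; rewrite mxE; apply: (gradingN (gr_grading R)). Qed.

Lemma row_homogZ n g h (c : R) (a : 'rV[R]_n) :
  gr_homog g c -> row_homog h a -> row_homog (g + h) (c *: a).
Proof. by move=> Hc Ha j; rewrite mxE; apply: gr_homogM. Qed.

Lemma row_homog_kmx (y : nat -> R) g (Hy : forall j, gr_homog g (y j)) k i h
    (v : 'rV[R]_(ksz k i.+1)) : row_homog h v -> row_homog (g + h) (v *m kmx y k i).
Proof.
elim: k i v => [|k IHk] i v Hv.
  by rewrite mulmx0 => j; rewrite mxE; apply: (grading0 (gr_grading R)).
move: Hv; rewrite -[v](hsubmxK (n1 := ksz k i.+1) (n2 := ksz k i)).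
move: (lsubmx _) (rsubmx _) => a b /row_homog_mx; case: i a b {v} => [|i] a b [Ha Hb].
  by rewrite mul_row_kmx0; apply: row_homogD; [apply: (IHk 0%N)|apply: row_homogZ].
rewrite mul_row_kmxS; apply/row_homog_mx; split.
  by apply: row_homogD; [apply: (IHk i.+1)|apply: row_homogZ].
by apply: row_homogN; apply: (IHk i).
Qed.

End HomogeneousRows.

(** * Diagonals of bigraded modules *)

Section BigradedModules.
Variables (G : zmodType) (R : graded_ring G).

Section RowModule.
Variables (n : nat) (u : G).

Lemma row_grading : is_grading (fun g (v : 'rV[R]_n) => row_homog (g - u) v).
Proof.
have RG := gr_grading R.
split=> [g j|g a b Ha Hb|v|s f us Hf f0 g gs].
- by rewrite mxE; apply: (grading0 RG).
- by apply: row_homogD => //; apply: row_homogN.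
- have /choice[s sE] (j : 'I_n) := hcomp_sum RG (v 0 j).
  pose t := undup (flatten [seq s j | j : 'I_n]).
  exists [seq \row_j hcomp RG g (v 0 j) | g <- t].
    move=> _ /mapP[g _ ->]; exists (g + u) => j.
    by rewrite addrK mxE; apply: hcompP.
  apply/rowP => j; rewrite big_map summxE [LHS](sE j t) ?undup_uniq //.
    by apply: eq_bigr => g _; rewrite mxE.
  move=> g gs; rewrite mem_undup; apply/flattenP; exists (s j) => //.
  by apply/mapP; exists j; rewrite ?mem_enum.
- apply/rowP => j; rewrite mxE.
  apply: (grading_indep (grading_sub RG u) us (f := fun g => f g 0 j)) gs.
    by move=> h /Hf; apply.
  by rewrite -[LHS]summxE f0 mxE.
Qed.

Lemma row_homogZ_sub g h (c : R) (v : 'rV[R]_n) :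
  gr_homog g c -> row_homog (h - u) v -> row_homog (g + h - u) (c *: v).
Proof. by rewrite -addrA; apply: row_homogZ. Qed.

Definition row_module : graded_module R :=
  @GradedModule G R 'rV[R]_n (fun g => row_homog (g - u)) row_grading row_homogZ_sub.

End RowModule.

Definition shift_regular (u : G) := shift_module (regular_module R) u.

Section Maps.
Variables (n : nat) (u : G).

Lemma row_inr_linear :
  linear ((fun v => row_mx 0 v) : row_module n u -> row_module (1 + n) u).
Proof. by move=> a x y; rewrite scale_row_mx add_row_mx scaler0 addr0. Qed.
Lemma row_inr_homog g (v : row_module n u) :
  gm_homog g v -> gm_homog g (row_mx 0 v : row_module (1 + n) u).
Proof.
move=> Hv; apply/row_homog_mx; split=> // j.
by rewrite mxE; apply: (grading0 (gr_grading R)).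
Qed.
Definition row_inr := GHom row_inr_linear row_inr_homog.

Lemma row_coord_linear j :
  linear ((fun v => v 0 j) : row_module n u -> shift_regular u).
Proof. by move=> a x y; rewrite !mxE. Qed.
Definition row_coord j : ghom (row_module n u) (shift_regular u) :=
  @GHom _ _ (row_module n u) (shift_regular u) _ (@row_coord_linear j)
    (fun g v Hv => Hv j).

Lemma row_const_linear :
  linear ((fun r => const_mx r) : shift_regular u -> row_module n u).
Proof. by move=> a x y; apply/rowP => j; rewrite !mxE. Qed.
Lemma row_const_homog g (r : shift_regular u) :
  gm_homog g r -> gm_homog g (const_mx r : row_module n u).
Proof. by move=> Hr j; rewrite mxE. Qed.
Definition row_const := GHom row_const_linear row_const_homog.

End Maps.

Lemma row_ses n u : ses (row_module n u) (row_module n.+1 u) (shift_regular u).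
Proof.
exists (row_inr n u), (row_coord (n := 1 + n) u (lshift n 0)); split.
- by move=> v w vw; have [] := @eq_row_mx _ 1 1 n 0 v 0 w vw.
- by move=> r; exists (const_mx r); rewrite /= mxE.
- move=> v; split=> [v0|[w ->]] /=; last by rewrite row_mxEl mxE.
  have l0 : lsubmx (v : 'rV_(1 + n)) = 0 by apply/rowP => j; rewrite !mxE ord1.
  exists (rsubmx (v : 'rV_(1 + n))); rewrite -l0.
  exact: esym (hsubmxK (v : 'rV_(1 + n))).
Qed.

Section Kmx.
Variables (y : nat -> R) (g : G) (Hy : forall j, gr_homog g (y j)) (k i : nat) (u : G).
Lemma kmx_linear :
  linear (mulmx^~ (kmx y k i) : row_module (ksz k i.+1) (u + g) -> row_module (ksz k i) u).
Proof. by move=> a v w; rewrite mulmxDl -scalemxAl. Qed.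
Lemma kmx_homog h (v : row_module (ksz k i.+1) (u + g)) :
  gm_homog h v -> gm_homog h (v *m kmx y k i : row_module (ksz k i) u).
Proof.
move=> /(row_homog_kmx Hy); congr (row_homog _ _).
by rewrite opprD addrCA [g + _]addrC subrK.
Qed.
Definition kmx_hom := GHom kmx_linear kmx_homog.
End Kmx.

Section Scale.
Variables (f : R) (e : G) (Hf : gr_homog e f) (u : G).
Lemma mulhom_linear :
  linear (( *%R f) : shift_regular (u + e) -> shift_regular u).
Proof. by move=> a x y; rewrite mulrDr mulrCA. Qed.
Lemma mulhom_homog g (x : shift_regular (u + e)) :
  gm_homog g x -> gm_homog g (f * x : shift_regular u).
Proof.
move=> Hx; have := gr_homogM Hf Hx; congr (gr_homog _ _).
by rewrite opprD addrCA [e + _]addrC subrK.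
Qed.
Definition mulhom := GHom mulhom_linear mulhom_homog.
End Scale.

End BigradedModules.

Section DiagonalFunctor.
Variable R : graded_ring (int * int)%type.
Implicit Types X Y Z : graded_module R.

Lemma diag_mem_homog X i (x : X) : gm_homog (i, i) x -> x \in diag_mem (M:=X).
Proof. by move=> Hx; apply/diag_memP/span_mem; exists i. Qed.

Section Hom.
Variables (X Y : graded_module R) (f : ghom X Y).

Lemma diag_hom_mem (x : diag_type X) : f (val x) \in diag_mem (M:=Y).
Proof.
have /diag_memP := valP x; move: (val x) => {}x Dx; apply/diag_memP.
move: Dx; apply: (span_map (f := f)) => v [i Hv]; apply: span_mem.
by exists i; apply: ghom_homog.
Qed.

Definition diag_fun (x : diag_module X) : diag_module Y := Sub (f (val x) : Y) (diag_hom_mem x).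

Lemma diag_fun_linear : linear diag_fun.
Proof. by move=> a x y; apply: val_inj; apply: (ghom_linear f). Qed.
Lemma diag_fun_homog i x : gm_homog i x -> gm_homog i (diag_fun x).
Proof. by move=> Hx; apply: (ghom_homog f (g := (i, i))). Qed.
Definition diag_hom := GHom diag_fun_linear diag_fun_homog.

Lemma diag_homE x : val (diag_hom x) = f (val x).
Proof. by []. Qed.
End Hom.

Lemma diag_lift X Y (f : ghom X Y) i (y : diag_module Y) :
  gm_homog i y -> (exists x, val y = f x) -> exists z, y = diag_hom f z.
Proof.
move=> Hy [x yE].
have Hx : gm_homog (i, i) (gcomp (i, i) x) by apply: hcompP.
exists (Sub (gcomp (i, i) x : X) (diag_mem_homog Hx)); apply: val_inj.
by rewrite diag_homE SubK -ghom_gcomp -yE hcomp_id.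
Qed.

(** Only bidegrees (i, i) are tested: this lets complexes with homology off the diagonal be used. *)
Lemma diag_exact X Y Z (f : ghom X Y) (h : ghom Y Z) :
  (forall i y, gm_homog (i, i) y -> h y = 0 -> exists x, y = f x) ->
  forall y, diag_hom h y = 0 -> exists x, y = diag_hom f x.
Proof.
move=> fh; apply: exact_homog => i y Hy hy; apply: (diag_lift Hy).
by apply: (fh i) => //; rewrite -diag_homE hy.
Qed.

Lemma diag_surj X Y (f : ghom X Y) :
  (forall i y, gm_homog (i, i) y -> exists x, y = f x) -> surj (diag_hom f).
Proof.
move=> f_surj y; have [i z Hz _||x ->] := @diag_exact X Y Y f (ghom_0 Y Y) _ y.
- exact: f_surj Hz.
- exact: val_inj.
- by exists x.
Qed.

Lemma diag_ses X Y Z : ses X Y Z -> ses (diag_module X) (diag_module Y) (diag_module Z).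
Proof.
move=> [f [h [f_inj h_surj fh]]]; exists (diag_hom f), (diag_hom h); split.
- by move=> x y xy; apply/val_inj/f_inj; rewrite -!diag_homE xy.
- by apply: diag_surj => i z _; have [x <-] := h_surj z; exists x.
- move=> y; split; first by apply: diag_exact => i z _ /fh.
  by move=> [x ->]; apply: val_inj; rewrite !diag_homE; apply/fh; exists (val x).
Qed.

Definition diag_row n u := diag_module (row_module R n u).
Definition diag_shift u := diag_module (shift_regular R u).

Lemma reg_le_diag_row k n u d : reg_le k (diag_shift u) d -> reg_le k (diag_row n u) d.
Proof.
move=> ku; elim: n => [|n IHn].
  by apply: reg_le_zero => x; apply: val_inj; apply: thinmx0.
exact: reg_le_extension (diag_ses (row_ses R n u)) IHn ku.
Qed.

Lemma reg_le_diag_row1 k u d : reg_le k (diag_row 1 u) d -> reg_le k (diag_shift u) d.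
Proof.
move=> ku; apply: (reg_le_retract (i := diag_hom (row_const R 1 u))
  (p := diag_hom (row_coord R u 0)) _ ku) => x.
by apply: val_inj; rewrite !diag_homE /= mxE.
Qed.

Lemma diag_shift_cyclic e : exists w : diag_shift (e, e), cyclic_free e w.
Proof.
have memE (x : R) : x \in diag_mem (M:=shift_regular R (e, e)) ->
    x \in diag_mem (M:=regular_module R).
  move=> /diag_memP[s Ps xE]; apply/diag_memP; exists s => // v /Ps[i Hv].
  by exists (i - e).
have H1 : gm_homog (e, e) (1 : shift_regular R (e, e)).
  by rewrite /= subrr; apply: gr_homog1.
exists (Sub (1 : shift_regular R (e, e)) (diag_mem_homog H1)); split=> // x.
exists (Sub (val x : R) (memE _ (valP x))); split=> [|a xE].
  by apply: val_inj; apply: esym (mulr1 _).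
by apply: val_inj; rewrite xE; apply: mulr1.
Qed.

Lemma reg_le_diag_shift k e : reg_le k (diag_shift (e, e)) e.
Proof.
have [w Fw] := diag_shift_cyclic e.
exact/reg_le_ffree/(ffree_cyclic (lexx e) Fw).
Qed.

End DiagonalFunctor.

Section DiagonalReduction.
Variables (R' R : graded_ring (int * int)%type) (psi : {rmorphism R' -> R}).
Hypothesis psi_homog : forall g x, gr_homog g x -> gr_homog g (psi x).

Lemma diag_ring_map_mem (x : diag_ring R') :
  psi (val x) \in diag_mem (M:=regular_module R).
Proof.
have /diag_memP := valP x; move: (val x) => {}x Dx; apply/diag_memP.
move: Dx; apply: (span_map (f := psi)) => v [i Hv]; apply: span_mem.
by exists i; apply: psi_homog.
Qed.

Definition diag_ring_map (x : diag_ring R') : diag_ring R :=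
  Sub (psi (val x) : R) (diag_ring_map_mem x).

Lemma diag_ring_map_zmod : zmod_morphism diag_ring_map.
Proof. by move=> x y; apply: val_inj; apply: raddfB. Qed.
Lemma diag_ring_map_monoid : monoid_morphism diag_ring_map.
Proof.
by split=> [|x y]; apply: val_inj; [apply: rmorph1|apply: rmorphM].
Qed.
HB.instance Definition _ :=
  GRing.isZmodMorphism.Build (diag_ring R') (diag_ring R) diag_ring_map diag_ring_map_zmod.
HB.instance Definition _ :=
  GRing.isMonoidMorphism.Build (diag_ring R') (diag_ring R) diag_ring_map diag_ring_map_monoid.

Definition diag_rmorphism : {rmorphism diag_ring R' -> diag_ring R} := diag_ring_map.

Lemma diag_rmorphism_homog i x : gr_homog i x -> gr_homog i (diag_rmorphism x).
Proof. exact: psi_homog. Qed.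

Definition diag_restr (M : graded_module (diag_ring R)) : graded_module (diag_ring R') :=
  restr diag_rmorphism_homog M.

Section Projection.
Variable u : int * int.

Lemma diag_proj_mem (x : diag_shift R' u) :
  psi (val x) \in diag_mem (M:=shift_regular R u).
Proof.
have /diag_memP := valP x; move: (val x) => {}x Dx; apply/diag_memP.
move: Dx; apply: (span_map (f := psi)) => v [i Hv]; apply: span_mem.
by exists i; apply: psi_homog.
Qed.

Definition diag_proj_fun (x : diag_shift R' u) : diag_restr (diag_shift R u) :=
  Sub (psi (val x) : shift_regular R u) (diag_proj_mem x) : diag_shift R u.

Lemma diag_proj_linear : linear diag_proj_fun.
Proof.
move=> b x y; apply: (@val_inj _ _ (diag_shift R u)).
apply: etrans (raddfD psi _ _) _; congr (_ + _).
exact: rmorphM.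
Qed.
Lemma diag_proj_homog i x : gm_homog i x -> gm_homog i (diag_proj_fun x).
Proof. by move=> Hx; apply: psi_homog. Qed.
Definition diag_proj := GHom diag_proj_linear diag_proj_homog.

End Projection.

Variables (f : R') (e : int * int).
Hypothesis Hf : gr_homog e f.
Hypothesis f_reg : forall x, f * x = 0 -> x = 0.
Hypothesis psi_lift : forall g y, gr_homog g y -> exists2 x, gr_homog g x & psi x = y.
Hypothesis psi_ker : forall x, psi x = 0 <-> exists z, x = f * z.

Lemma diag_reduction_ses u :
  ses (diag_shift R' (u + e)) (diag_shift R' u) (diag_restr (diag_shift R u)).
Proof.
exists (diag_hom (mulhom Hf u)), (diag_proj u); split.
- move=> x y xy; apply/val_inj/subr0_eq/f_reg; rewrite mulrBr.
  by apply/eqP; rewrite subr_eq0; apply/eqP/(congr1 val xy).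
- apply: surj_homog => i y Hy; have [x Hx xy] := psi_lift Hy.
  exists (Sub (x : shift_regular R' u) (diag_mem_homog (X := shift_regular R' u) Hx)).
  by apply: (@val_inj _ _ (diag_shift R u)); rewrite /= xy.
- move=> y; split=> [|[x ->]]; last first.
    apply: (@val_inj _ _ (diag_shift R u)); apply/psi_ker; by exists (val x).
  move: y; apply: exact_homog => i y Hy py0.
  have /psi_ker[z yE] : psi (val y) = 0 by apply: (congr1 val py0).
  by apply: (diag_lift Hy); exists z.
Qed.

(** The first two hypotheses bound R(-u)_Delta over R'_Delta. The third does the same for the shifts
    (i, i), where R(-i, -i)_Delta is R_Delta(-i): its bound i + 1 is what the change of rings
    requires. *)
Lemma reg_le_reduction k u d :
  (forall l, reg_le l (diag_shift R' u) d) ->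
  (forall l, reg_le l (diag_shift R' (u + e)) (d + 1)) ->
  (forall l i, reg_le l (diag_shift R' ((i, i) + e)) (i + 1 + 1)) ->
  reg_le k (diag_shift R u) d.
Proof.
move=> ku kue ki; apply: (@reg_le_change_of_rings _ _ _ diag_rmorphism_homog _ k (diag_shift R u) d) => [i|l].
  have [w Fw] := diag_shift_cyclic R i.
  exists (diag_shift R (i, i)), w; split=> // l.
  apply: reg_le_quotient (diag_reduction_ses (i, i)) _ (fun j _ => ki j i).
  by apply: reg_le_mono (reg_le_diag_shift R' l i); rewrite lerDl.
exact: reg_le_quotient (diag_reduction_ses u) (ku l) (fun j _ => kue j).
Qed.

End DiagonalReduction.

Section KoszulRegularity.
Variables (R : graded_ring (int * int)%type) (y : nat -> R) (g : int * int) (k : nat).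
Hypothesis Hy : forall j, gr_homog g (y j).

(* Exactness at K_{i+1} and K_0 in total degree h; the generators of K_i have
   degree i g. *)
Definition kexact_at (i : nat) (h : int * int) : Prop :=
  forall v : 'rV[R]_(ksz k i.+1), row_homog (h - g *+ i.+1) v ->
  v *m kmx y k i = 0 -> kexact y v.

Definition kexact0_at (h : int * int) : Prop :=
  forall v : 'rV[R]_(ksz k 0), row_homog h v -> kexact y v.

(** An iteration rather than [u + g *+ i], so that consecutive shifts differ by [g] up to
    conversion, as the type of [kmx_hom] demands. *)
Let ush (u : int * int) (i : nat) := iter i (+%R^~ g) u.

Lemma ushE u i : ush u i = u + g *+ i.
Proof.
elim: i => [|i IHi]; first by rewrite addr0.
by rewrite /ush iterS -[iter i _ _]/(ush u i) IHi mulrSr addrA.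
Qed.

Let C u i := diag_row R (ksz k i) (ush u i).
Let D u i : ghom (C u i.+1) (C u i) := diag_hom (kmx_hom Hy k i (ush u i)).

Lemma diag_kmx_exact u i : (forall l : int, kexact_at i ((l, l) - u)) ->
  forall x, D u i x = 0 <-> exists z, x = D u i.+1 z.
Proof.
move=> ex x; split=> [|[z ->]]; last first.
  by apply: val_inj; apply: mulmx_kmx_kmx.
apply: diag_exact => l v Hv v0; apply: (ex l) => //.
by rewrite -addrA -opprD -ushE.
Qed.

(** K_0 is R(-u) itself. When the diagonal bidegrees see no homology even at K_0, the tail K_1, K_2,
    ... resolves R(-u)_Delta, and K_{i+1} is a sum of copies of R(-u - (i + 1) g). *)
Lemma reg_le_koszul l u d : (forall i j, kexact_at i ((j, j) - u)) ->
  (forall j : int, kexact0_at ((j, j) - u)) ->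
  (forall i, (i <= l)%N -> reg_le (l - i) (diag_shift R (u + g *+ i.+1)) (d + i%:Z)) ->
  reg_le l (diag_shift R u) d.
Proof.
move=> ex ex0 lu; apply: reg_le_diag_row1.
apply: (reg_le_resolution (C := fun i => C u i.+1) (D := fun i => D u i.+1)
  (p := D u 0)).
- by apply: diag_surj => j v Hv; apply: (ex0 j).
- exact: diag_kmx_exact.
- by move=> i; apply: diag_kmx_exact.
- by move=> i il; apply: reg_le_diag_row; rewrite ushE; apply: lu.
Qed.

Lemma diag_mem_shift0 (x : diag_row R 1 0) :
  (val x : 'rV_1) 0 0 \in diag_mem (M:=regular_module R).
Proof.
have /diag_memP := valP x; move: (val x) => {}x Dx; apply/diag_memP.
move: Dx; apply: (span_map (f := row_coord R 0 0)) => v [i Hv].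
by apply: span_mem; exists i; have := Hv 0; rewrite subr0.
Qed.

Definition row_residue_fun (x : diag_row R 1 0) : residue_module (diag_ring R) :=
  qpi (irrelevant_ideal (diag_ring R))
    (Sub ((val x : 'rV_1) 0 0 : R) (diag_mem_shift0 x) : diag_ring R).

Lemma row_residue_linear : linear row_residue_fun.
Proof.
move=> a x z; apply: esym; apply: etrans (congr2 +%R (qscale_pi _ _ _) erefl) _.
apply: etrans (esym (raddfD _ _ _)) _; congr (qpi _ _).
by apply: val_inj; rewrite /= !mxE.
Qed.
Lemma row_residue_homog i x : gm_homog i x -> gm_homog i (row_residue_fun x).
Proof.
move=> Hx; exists (Sub ((val x : 'rV_1) 0 0 : R) (diag_mem_shift0 x) : diag_ring R) => //.
by have := Hx 0; rewrite subr0.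
Qed.
Definition row_residue := GHom row_residue_linear row_residue_homog.

Hypothesis R_diag_ge0 : forall (j : int) (x : R), j < 0 -> gr_homog (j, j) x -> x = 0.
Hypothesis R_diag_gt0 : forall (j : int) (x : R),
  j <= 0 -> gr_homog ((j, j) - g) x -> x = 0.

Lemma row_residue_surj : surj row_residue.
Proof.
apply: surj_homog => i z [v Hv ->].
have Hv' : gm_homog (i, i) (const_mx (val v) : row_module R 1 0).
  by move=> j; rewrite mxE subr0.
exists (Sub (const_mx (val v) : row_module R 1 0) (diag_mem_homog Hv')).
by congr (qpi _ _); apply: val_inj; rewrite /= mxE.
Qed.

(** In positive degrees A_+ is all of R_Delta, and exactness at K_0 says that K_1 covers it. In the
    other degrees both A_+ and the diagonal of K_1 vanish. *)
Lemma row_residue_exact : (forall j : int, 0 < j -> kexact0_at (j, j)) ->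
  forall x, row_residue x = 0 <-> exists z, x = D 0 0 z.
Proof.
move=> ex0 x; split=> [|[z ->]].
  move: x; apply: exact_homog => i x Hx /qpi_eq0 Ix.
  have Hx' : row_homog (i, i) (val x : 'rV_1) by have := Hx; rewrite /= /diag_homog /= subr0.
  apply: (diag_lift Hx); case: (ltP 0 i) => [i0|i0]; first exact: (ex0 i).
  exists 0; rewrite ghom0; apply/rowP => j; rewrite ord1 mxE.
  apply: (congr1 val (irr_mul_bottom (M := regular_module (diag_ring R)) (d := i) _ _ Ix)).
    move=> l a li Ha; apply: val_inj; apply: (R_diag_ge0 (j := l)) => //.
    exact: lt_le_trans i0.
  exact: (Hx' 0).
apply: (hcomp_eq0 (HG := gm_grading _)) => i; rewrite !ghom_gcomp.
have : gm_homog i (gcomp i z) by apply: hcompP.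
move: (gcomp i z) => {}z Hz; case: (ltP 0 i) => [i0|i0].
  apply/qpi_eq0/span_mem; exists i.
  exists (Sub ((val (D 0 0 z) : 'rV_1) 0 0 : R) (diag_mem_shift0 (D 0 0 z)) : diag_ring R).
  exists (1 : diag_ring R); split=> //; last by rewrite -[RHS]/(_ * _) mulr1.
  by have := ghom_homog (D 0 0) Hz 0; rewrite /ush /= subr0.
suff -> : z = 0 by rewrite !ghom0.
apply: val_inj; apply/rowP => j; rewrite [RHS]mxE; apply: (R_diag_gt0 i0).
apply: (@eq_ind _ _ (fun h => gr_homog h (val z 0 j)) (Hz j)).
by rewrite /ush /= add0r.
Qed.

Lemma reg_le_residue l : (forall i (j : int), kexact_at i (j, j)) ->
  (forall j : int, 0 < j -> kexact0_at (j, j)) ->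
  (forall i, (i <= l)%N -> reg_le (l - i) (diag_shift R (g *+ i)) i%:Z) ->
  reg_le l (residue_module (diag_ring R)) 0.
Proof.
move=> ex ex0 lu; apply: (reg_le_resolution (C := C 0) (D := D 0) (p := row_residue)).
- exact: row_residue_surj.
- exact: row_residue_exact.
- by move=> i; apply: diag_kmx_exact => j; rewrite subr0.
- by move=> i il; apply: reg_le_diag_row; rewrite ushE !add0r; apply: lu.
Qed.

End KoszulRegularity.

(** * Reduction modulo a regular element of bidegree (2, 1) *)

Definition reg_bounded (R : graded_ring (int * int)%type) : Prop :=
  forall l a b, reg_le l (diag_shift R (a, b)) (Num.max a b).

(** The induction hypothesis on the ring, phrased so that the quotient by f inherits it. In its use
    [y] lists the images of t_1, ..., t_n, followed by zeros. *)
Record strip_koszul (R : graded_ring (int * int)%type) (y : nat -> R) (k : nat) :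
    Prop := StripKoszul {
  strip_homog : forall j, gr_homog (0, 1) (y j);
  strip_ge0 : forall (h : int * int) (x : R),
    gr_homog h x -> (h.1 < 0) || (h.2 < 0) -> x = 0;
  strip_exact0 : forall h : int * int, 0 < h.2 -> kexact0_at y k h;
  strip_exact : forall (h : int * int) i, h.1 <= h.2 -> kexact_at y (0, 1) k i h }.

Lemma pair01_mulrn i : (0, 1) *+ i = (0, i%:Z) :> (int * int)%type.
Proof.
elim: i => [//|i IHi]; rewrite mulrS IHi.
by congr pair; rewrite /= ?addr0 ?intS.
Qed.

Lemma pair10_mulrn i : (1, 0) *+ i = (i%:Z, 0) :> (int * int)%type.
Proof.
elim: i => [//|i IHi]; rewrite mulrS IHi.
by congr pair; rewrite /= ?addr0 ?intS.
Qed.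

Section StripRegularity.
Variables (R : graded_ring (int * int)%type) (y : nat -> R) (k : nat).
Hypothesis Hs : strip_koszul y k.

Lemma row_homog_lt0 n h (v : 'rV[R]_n) :
  row_homog h v -> (h.1 < 0) || (h.2 < 0) -> v = 0.
Proof. by move=> Hv h0; apply/rowP => j; rewrite mxE; apply: strip_ge0 Hs _ _ (Hv j) h0. Qed.

Lemma kexact_0 i : kexact y (0 : 'rV[R]_(ksz k i)).
Proof. by exists 0; rewrite mul0mx. Qed.

(** On the diagonal R(-a, -b) shows the bidegrees (j - a, j - b), whose first entry is the smaller
    one. The term R(-a, -b - 1 - i) has regularity at most max(a, b + 1 + i) <= a + i. Only i = 0
    needs all [l] steps, hence its separate hypothesis. *)
Lemma strip_reg_step l a b : b < a ->
  (forall i, (i < l)%N -> forall c d, reg_le i (diag_shift R (c, d)) (Num.max c d)) ->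
  reg_le l (diag_shift R (a, b + 1)) a -> reg_le l (diag_shift R (a, b)) a.
Proof.
move=> ba IH l1; apply: (reg_le_koszul (strip_homog Hs) (k := k)).
- by move=> i j; apply: (strip_exact Hs) => /=; lia.
- move=> j v Hv; case: (ltP (j - a) 0) => ja.
    by rewrite (row_homog_lt0 Hv) ?ja //; apply: kexact_0.
  by apply: (strip_exact0 Hs) Hv => /=; lia.
- move=> [|i] il; rewrite pair01_mulrn.
    by rewrite subn0 addr0; have -> : (a, b) + (0, 1%:Z) = (a, b + 1)
      by congr pair; rewrite /= addr0.
  have -> : (a, b) + (0, i.+2%:Z) = (a, b + i.+2%:Z) by congr pair; rewrite /= addr0.
  apply: reg_le_mono (IH _ _ _ _); last by lia.
  by rewrite ge_max; apply/andP; split; lia.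
Qed.

(** Induction on the number of steps, then on |a - b|, starting from the free modules on the
    diagonal a = b. The case a < b stays a hypothesis because the polynomial ring and its quotients
    settle it differently. *)
Lemma strip_reg_bounded :
  (forall l a b, a < b ->
    (forall i, (i < l)%N -> forall c d, reg_le i (diag_shift R (c, d)) (Num.max c d)) ->
    reg_le l (diag_shift R (a + 1, b)) b -> reg_le l (diag_shift R (a, b)) b) ->
  reg_bounded R.
Proof.
move=> step l; elim/ltn_ind: l => l IHl a b.
have [n] : exists n : nat, (`|a - b| <= n)%N by exists `|a - b|%N.
elim: n a b => [|n IHn] a b abn.
  have -> : b = a by lia.
  by rewrite maxxx; apply: reg_le_diag_shift.
case: (ltgtP a b) => [ab|ba|->]; last exact: reg_le_diag_shift.
  apply: step => //; rewrite -[X in reg_le _ _ X](@max_r _ _ (a + 1) b); last by lia.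
  by apply: IHn; lia.
apply: strip_reg_step => //; rewrite -[X in reg_le _ _ X](@max_l _ _ a (b + 1)); last by lia.
by apply: IHn; lia.
Qed.

Lemma strip_reg_residue : reg_bounded R ->
  forall l, reg_le l (residue_module (diag_ring R)) 0.
Proof.
move=> Rb l; apply: (reg_le_residue (strip_homog Hs) (k := k)).
- by move=> j x j0 Hx; apply: strip_ge0 Hs _ _ Hx _; rewrite /= j0.
- move=> j x j0 Hx; apply: strip_ge0 Hs _ _ Hx _; apply/orP; right => /=; lia.
- by move=> i j; apply: (strip_exact Hs).
- by move=> j j0; apply: (strip_exact0 Hs).
- move=> i _; rewrite pair01_mulrn -[X in reg_le _ _ X](@max_r _ _ 0 i%:Z) //.
Qed.

End StripRegularity.

Lemma kexact_homog (R : graded_ring (int * int)%type) (y : nat -> R) g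
    (Hy : forall j, gr_homog g (y j)) k i h (v : 'rV[R]_(ksz k i)) :
  kexact y v -> row_homog (g + h) v -> exists2 w, row_homog h w & v = w *m kmx y k i.
Proof.
move=> [w vE] Hv.
pose f := kmx_hom Hy k i 0.
have Hv' : gm_homog (g + h) (v : row_module R (ksz k i) 0) by rewrite /= subr0.
exists (gcomp (g + h) (w : row_module R (ksz k i.+1) (0 + g))).
  have /= := hcompP (gm_grading (row_module R (ksz k i.+1) (0 + g))) (g + h) w.
  by rewrite add0r [g + h - _]addrAC subrr add0r.
by rewrite -[LHS](hcomp_id (gm_grading _) Hv') vE; apply: (ghom_gcomp f).
Qed.

Section StripReduction.
Variables (R' R : graded_ring (int * int)%type) (psi : {rmorphism R' -> R}).
Variables (f : R') (y : nat -> R') (k : nat).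
Hypothesis psi_homog : forall g x, gr_homog g x -> gr_homog g (psi x).
Hypothesis Hf : gr_homog (2, 1) f.
Hypothesis f_reg : forall x, f * x = 0 -> x = 0.
Hypothesis psi_lift : forall g y, gr_homog g y -> exists2 x, gr_homog g x & psi x = y.
Hypothesis psi_ker : forall x, psi x = 0 <-> exists z, x = f * z.
Hypothesis Hs : strip_koszul y k.

Lemma row_lift n g (v : 'rV[R]_n) : row_homog g v ->
  exists2 w : 'rV[R']_n, row_homog g w & map_mx psi w = v.
Proof.
move=> Hv; have /choice[w wE] (j : 'I_n) : exists x, gr_homog g x /\ psi x = v 0 j.
  by have [x] := psi_lift (Hv j); exists x.
exists (\row_j w j) => [j|]; first by rewrite mxE; case: (wE j).
by apply/rowP => j; rewrite !mxE; case: (wE j).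
Qed.

Lemma row_ker n g (v : 'rV[R']_n) : row_homog g v -> map_mx psi v = 0 ->
  exists2 w, row_homog (g - (2, 1)) w & v = f *: w.
Proof.
move=> Hv v0; have /choice[w wE] (j : 'I_n) : exists x, v 0 j = f * x.
  by apply/psi_ker; have := congr1 (fun u : 'rV_n => u 0 j) v0; rewrite !mxE.
exists (\row_j hcomp (gr_grading R') (g - (2, 1)) (w j)) => [j|].
  by rewrite mxE; apply: hcompP.
apply/rowP => j; rewrite !mxE -[LHS](hcomp_id (gr_grading R') (Hv j)) wE.
rewrite -{1}[g](subrK (2, 1)) addrC.
exact: (gcompZ (M := regular_module R') (g - (2, 1)) (w j) Hf).
Qed.

Lemma strip_reduction : strip_koszul (psi \o y) k.
Proof.
split=> [j|h x Hx h0|h h0 v Hv|h i h12 v Hv v0].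
- exact/psi_homog/(strip_homog Hs).
- have [z Hz <-] := psi_lift Hx.
  by rewrite (strip_ge0 Hs Hz h0) rmorph0.
- have [z Hz <-] := row_lift Hv.
  have [w ->] := strip_exact0 Hs h0 Hz.
  by exists (map_mx psi w); rewrite map_mxM map_kmx.
have [z Hz zv] := row_lift Hv.
have Hzk := row_homog_kmx (strip_homog Hs) Hz.
have [|b Hb bE] := row_ker Hzk; first by rewrite map_mxM map_kmx zv.
(* The lift [z] need not be a cycle: its differential is f b, with [b] one homological degree lower
   and in total bidegree h - (2, 1). At K_0 there is no cycle condition to use: either h.1 < 2 and b
   = 0 for degree reasons, or h.2 >= h.1 >= 2 and [strip_exact0] applies. *)
have [w bw] : kexact y b.
  case: i => [|i] in v Hv v0 z Hz zv Hzk b Hb bE *.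
    case: (ltP (h.1 - 2) 0) => h2.
      rewrite (row_homog_lt0 Hs Hb); last by rewrite /=; lia.
      exact: kexact_0.
    by apply: (strip_exact0 Hs) Hb => /=; lia.
  apply: (strip_exact Hs (h := h - (2, 1))); first by rewrite /=; lia.
    by move: Hb; congr (row_homog _ _); rewrite mulrS opprD addrCA addNKr addrAC.
  have : f *: (b *m kmx y k i) = 0 by rewrite scalemxAl -bE mulmx_kmx_kmx.
  move: (b *m _) => c /rowP fc; apply/rowP => j; rewrite mxE; apply: f_reg.
  by have := fc j; rewrite !mxE.
(* Exactness over [R'] is known for homogeneous rows only, so [w] is replaced by a component. Then z
   - f w' is a cycle which still maps to [v]. *)
have [w' Hw' bw'] := @kexact_homog _ y (0, 1) (strip_homog Hs) k i (h - (0, 1) *+ i.+1 - (2, 1)) b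
  (ex_intro _ w bw) ltac:(by rewrite addrA).
have [||u uE] := strip_exact Hs h12 (v := z - f *: w').
- apply: (row_homogD Hz); apply: row_homogN.
  by have := row_homogZ Hf Hw'; rewrite addrC subrK.
- by rewrite mulmxBl -scalemxAl -bw' -bE subrr.
exists (map_mx psi u); rewrite -map_kmx -map_mxM -uE map_mxB map_mxZ.
by rewrite zv (psi_ker f).2 ?scale0r ?subr0 //; exists 1; rewrite mulr1.
Qed.

Lemma reg_bounded_reduction : reg_bounded R' -> reg_bounded R.
Proof.
move=> R'b; apply: (strip_reg_bounded strip_reduction) => l a b ab _ _.
apply: (reg_le_reduction psi_homog Hf f_reg psi_lift psi_ker) => [i|i|i j].
- by rewrite -[X in reg_le _ _ X](@max_r _ _ a b) ?ltW.
- by apply: reg_le_mono (R'b i (a + 2) (b + 1)); rewrite ge_max; apply/andP; split; lia.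
(* Here max(j + 2, j + 1) is exactly the bound j + 1 + 1 that the change of rings tolerates. *)
- by apply: reg_le_mono (R'b i (j + 2) (j + 1)); rewrite ge_max; apply/andP; split; lia.
Qed.

End StripReduction.

(** * The polynomial ring *)

Section KoszulExactness.
Variables (R : comPzRingType) (y : nat -> R).

Lemma kexactD k i (v w : 'rV[R]_(ksz k i)) :
  kexact y v -> kexact y w -> kexact y (v + w).
Proof. by move=> [a ->] [b ->]; exists (a + b); rewrite mulmxDl. Qed.

Lemma kexact0_var k i (v : 'rV[R]_(ksz k 0)) : (i < k)%N -> kexact y (y i *: v).
Proof.
elim: k v => [//|k IHk] v; rewrite ltnS leq_eqVlt => /predU1P[->|/(IHk v)[w wE]].
  by exists (row_mx 0 v); rewrite mul_row_kmx0 mul0mx add0r.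
by exists (row_mx w 0); rewrite mul_row_kmx0 scaler0 addr0.
Qed.

End KoszulExactness.

Section VariableSequence.
Variables (K : fieldType) (p q : nat) (s : 'I_p -> 'I_q).
Hypothesis s_inj : injective s.

(** The value 0 from index [p] on is homogeneous of every degree, so that the sequence is
    homogeneous at all indices. *)
Definition var_seq (j : nat) : {mpoly K[q]} :=
  oapp (fun i : 'I_p => 'X_(s i)) 0 (insub j).

Lemma var_seqE (i : 'I_p) : var_seq i = 'X_(s i).
Proof. by rewrite /var_seq valK. Qed.

Let var_supp k (f : {mpoly K[q]}) : Prop :=
  forall u, f@_u != 0 -> exists2 i : 'I_p, (i < k)%N & u (s i) != 0%N.

Let var_suppD k f g : var_supp k f -> var_supp k g -> var_supp k (f + g).
Proof.
move=> Sf Sg u; rewrite mcoeffD; have [f0|/Sf//] := eqVneq f@_u 0.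
by rewrite f0 add0r => /Sg.
Qed.

(** The image is the monomial ideal of the first [k] variables of the sequence, so membership is
    read off the exponents of each monomial. *)
Lemma kexact0_varP k (v : 'rV[{mpoly K[q]}]_(ksz k 0)) : (k <= p)%N ->
  kexact var_seq v <-> var_supp k (v 0 0).
Proof.
move=> kp; split=> [|Sv].
  elim: k kp v => [|k IHk] kp v [w ->].
    by move=> u; rewrite mulmx0 mxE mcoeff0 eqxx.
  rewrite -[w](hsubmxK (n1 := ksz k 1) (n2 := ksz k 0)) mul_row_kmx0 mxE.
  apply: var_suppD.
    move=> u /(IHk (ltnW kp) _ (ex_intro _ _ erefl))[i ik ui].
    by exists i => //; apply: ltnW.
  move=> u; rewrite mxE -[k]/(val (Ordinal kp)) var_seqE => fu.
  move: fu; rewrite mulrC -mcoeff_msupp (perm_mem (msuppMX _ _)) => /mapP[z _ ->].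
  by exists (Ordinal kp) => //; rewrite mnmDE mnm1E eqxx.
have -> : v = \sum_(u <- msupp (v 0 0)) const_mx ((v 0 0)@_u *: 'X_[u]).
  apply/rowP => j; rewrite ord1 summxE {1}[v 0 0]mpolyE.
  by apply: eq_bigr => u _; rewrite mxE.
elim/big_ind: _ => [|a b|u _]; first by exists 0; rewrite mul0mx.
  exact: kexactD.
have [->|/Sv[i ik ui]] := eqVneq (v 0 0)@_u 0.
  by exists 0; rewrite mul0mx scale0r; apply/rowP => j; rewrite !mxE.
have -> : const_mx ((v 0 0)@_u *: 'X_[u]) =
    var_seq i *: const_mx ((v 0 0)@_u *: 'X_[u - U_(s i)]) :> 'rV[{mpoly K[q]}]_(ksz k 0).
  apply/rowP => j; rewrite !mxE var_seqE -scalerAr -mpolyXD addmC submK //.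
  by rewrite lep1mP.
exact: kexact0_var.
Qed.

(** Multiplication by a variable of the sequence raises one exponent, which by injectivity of [s] is
    not that of an earlier variable; so it is regular modulo those. *)
Lemma var_seq_exact k i (v : 'rV[{mpoly K[q]}]_(ksz k i.+1)) : (k <= p)%N ->
  v *m kmx var_seq k i = 0 -> kexact var_seq v.
Proof.
move=> kp; apply: kmx_exact => j jk w.
have jp : (j < p)%N by apply: leq_trans kp.
rewrite !kexact0_varP ?(ltnW jp) // mxE -[j]/(val (Ordinal jp)) var_seqE => Sw u wu.
have [|i0 i0j] := Sw (u + U_(s (Ordinal jp)))%MM; first by rewrite mulrC addmC mcoeffMX.
rewrite mnmDE mnm1E; case: (s (Ordinal jp) =P s i0) => [/s_inj i0E|_]; last by rewrite addn0; exists i0.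
by move: i0j; rewrite -i0E /= ltnn.
Qed.

End VariableSequence.

Section Base.
Variables (K : fieldType) (m n : nat).
Notation S := (bigraded_mpoly K m n).

Definition xvar : nat -> S := var_seq K (lshift n (m:=m)).
Definition tvar : nat -> S := var_seq K (rshift m (n:=n)).

Lemma bideg_lshift i : bideg (U_(lshift n i) : 'X_{1..m + n})%MM = (1, 0).
Proof.
rewrite /bideg (bigD1 i) //= mnm1E eqxx big1 => [|j /negPf ji].
  by rewrite big1 // => j _; rewrite mnm1E eq_lrshift.
by rewrite mnm1E (inj_eq (@lshift_inj _ _)) eq_sym ji.
Qed.

Lemma bideg_rshift i : bideg (U_(rshift m i) : 'X_{1..m + n})%MM = (0, 1).
Proof.
rewrite /bideg big1 => [|j _]; last by rewrite mnm1E eq_rlshift.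
rewrite (bigD1 i) //= mnm1E eqxx big1 // => j /negPf ji.
by rewrite mnm1E (inj_eq (@rshift_inj _ _)) eq_sym ji.
Qed.

Lemma mpolyX_homog u : gr_homog (bideg u) ('X_[u] : S).
Proof. by move=> v; rewrite msuppX inE => /eqP->. Qed.

Lemma xvar_homog j : gr_homog (1, 0) (xvar j).
Proof.
rewrite /xvar /var_seq; case: insubP => [i _ _|_] /=; last by move=> u; rewrite msupp0.
by rewrite -(bideg_lshift i); apply: mpolyX_homog.
Qed.

Lemma tvar_homog j : gr_homog (0, 1) (tvar j).
Proof.
rewrite /tvar /var_seq; case: insubP => [i _ _|_] /=; last by move=> u; rewrite msupp0.
by rewrite -(bideg_rshift i); apply: mpolyX_homog.
Qed.

Lemma mpoly_homog_lt0 (h : int * int) (p : S) :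
  gr_homog h p -> (h.1 < 0) || (h.2 < 0) -> p = 0.
Proof.
move=> /bihomogP Hp h0; apply/mpolyP => u; rewrite mcoeff0; apply/eqP.
by apply: contraLR h0 => /Hp <-.
Qed.

Lemma xvar_exact0 (h : int * int) : 0 < h.1 -> kexact0_at xvar m h.
Proof.
move=> h0 v Hv; apply/kexact0_varP => // u.
have /bihomogP Hv0 := Hv 0; move=> /Hv0 uh.
case: (pickP (fun i => u (lshift n i) != 0%N)) => [i ui|u0]; first by exists i.
by move: h0; rewrite -uh /= big1 // => i _; apply/eqP; have /negbFE := u0 i.
Qed.

Lemma tvar_exact0 (h : int * int) : 0 < h.2 -> kexact0_at tvar n h.
Proof.
move=> h0 v Hv; apply/kexact0_varP => // u.
have /bihomogP Hv0 := Hv 0; move=> /Hv0 uh.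
case: (pickP (fun i => u (rshift m i) != 0%N)) => [i ui|u0]; first by exists i.
by move: h0; rewrite -uh /= big1 // => i _; apply/eqP; have /negbFE := u0 i.
Qed.

Section Transfer.
Variables (R : graded_ring (int * int)%type) (psi : {rmorphism S -> R}).
Hypothesis psi_homog : forall g x, gr_homog g x -> gr_homog g (psi x).
Hypothesis psi_lift : forall g y, gr_homog g y -> exists2 x, gr_homog g x & psi x = y.
Hypothesis psi_inj : injective psi.

Lemma kexact0_transfer y k h : @kexact0_at S y k h -> kexact0_at (psi \o y) k h.
Proof.
move=> ex v /(row_lift psi_lift)[w /ex[u ->] <-].
by exists (map_mx psi u); rewrite map_mxM map_kmx.
Qed.

Lemma kexact_transfer (y : nat -> S) k g i h :
  (forall v : 'rV[S]_(ksz k i.+1), v *m kmx y k i = 0 -> kexact y v) ->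
  kexact_at (psi \o y) g k i h.
Proof.
move=> ex v /(row_lift psi_lift)[w _ <-]; rewrite -map_kmx -map_mxM => w0.
have [|u ->] := ex w; last by exists (map_mx psi u); rewrite map_mxM map_kmx.
move: (w *m _) w0 => c /matrixP c0; apply/matrixP => a b; apply: psi_inj.
by have := c0 a b; rewrite !mxE rmorph0.
Qed.

(** Stated for a graded copy [R] of [S], because the induction starts at the quotient of [S] by the
    ideal of the empty sequence. *)
Lemma strip_koszul_base : strip_koszul (psi \o tvar) n.
Proof.
split=> [j|h x Hx h0|h h0|h i _].
- exact/psi_homog/tvar_homog.
- have [z Hz <-] := psi_lift Hx.
  by rewrite (mpoly_homog_lt0 Hz h0) rmorph0.
- exact/kexact0_transfer/tvar_exact0.
- by apply: kexact_transfer => v; apply: var_seq_exact => //; apply: rshift_inj.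
Qed.

(** For a < b this mirrors [strip_reg_step]: over the polynomial ring the complex of the x_i is
    exact in all positive homological degrees. *)
Lemma reg_bounded_base : reg_bounded R.
Proof.
apply: (strip_reg_bounded strip_koszul_base) => l a b ab IH l1.
have Hx j : gr_homog (1, 0) ((psi \o xvar) j) by apply/psi_homog/xvar_homog.
apply: (reg_le_koszul Hx (k := m)).
- move=> i j; apply: kexact_transfer => v; apply: var_seq_exact => //.
  exact: lshift_inj.
- move=> j v Hv; case: (ltP (j - b) 0) => jb.
    rewrite (row_homog_lt0 strip_koszul_base Hv); last by rewrite /= jb orbT.
    exact: kexact_0.
  by apply: (kexact0_transfer (xvar_exact0 _)) Hv => /=; lia.
- move=> [|i] il; rewrite pair10_mulrn.
    by rewrite subn0 addr0; have -> : (a, b) + (1%:Z, 0) = (a + 1, b)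
      by congr pair; rewrite /= addr0.
  have -> : (a, b) + (i.+2%:Z, 0) = (a + i.+2%:Z, b) by congr pair; rewrite /= addr0.
  by apply: reg_le_mono (IH _ _ (a + i.+2%:Z) b); [rewrite ge_max; apply/andP; split; lia|lia].
Qed.

End Transfer.
End Base.

Section QuotientMorphism.
Variables (G : zmodType) (A : graded_ring G) (I : graded_submod (regular_module A)).

Definition quot_proj (x : A) : quot_ring I := rpi I x.

Lemma quot_proj_zmod : zmod_morphism quot_proj.
Proof. exact: rpi_zmod. Qed.
Lemma quot_proj_monoid : monoid_morphism quot_proj.
Proof. by split=> // x y; apply: esym (qmul_pi _ _ _). Qed.
HB.instance Definition _ :=
  GRing.isZmodMorphism.Build A (quot_ring I) quot_proj quot_proj_zmod.
HB.instance Definition _ :=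
  GRing.isMonoidMorphism.Build A (quot_ring I) quot_proj quot_proj_monoid.

Lemma quot_proj_eq0 x : quot_proj x = 0 <-> I x.
Proof. exact: (@qpi_eq0 _ _ (regular_module A)). Qed.

Lemma quot_proj_homog g x : gr_homog g x -> gr_homog g (quot_proj x).
Proof. by move=> Hx; exists x. Qed.

Lemma quot_proj_lift g y : gr_homog g y -> exists2 x, gr_homog g x & quot_proj x = y.
Proof. by move=> [x Hx ->]; exists x. Qed.

Lemma quot_proj_surj y : exists x, quot_proj x = y.
Proof. by exists (rrepr y); apply: rreprK. Qed.

End QuotientMorphism.

Section IteratedQuotient.
Variables (G : zmodType) (A : graded_ring G) (I J : graded_submod (regular_module A)).
Hypothesis IJ : forall x, I x -> J x.

Definition quot_factor (x : quot_ring I) : quot_ring J := quot_proj J (rrepr x).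

Lemma quot_factor_proj x : quot_factor (quot_proj I x) = quot_proj J x.
Proof.
apply/(@qpi_eq _ _ (regular_module A))/IJ/(@qpi_eq _ _ (regular_module A)).
exact: rreprK.
Qed.

Lemma quot_factor_zmod : zmod_morphism quot_factor.
Proof.
move=> x y; have [u <-] := quot_proj_surj x; have [v <-] := quot_proj_surj y.
by rewrite -rmorphB !quot_factor_proj rmorphB.
Qed.
Lemma quot_factor_monoid : monoid_morphism quot_factor.
Proof.
split=> [|x y]; first exact: quot_factor_proj.
have [u <-] := quot_proj_surj x; have [v <-] := quot_proj_surj y.
by rewrite -rmorphM !quot_factor_proj rmorphM.
Qed.
HB.instance Definition _ :=
  GRing.isZmodMorphism.Build (quot_ring I) (quot_ring J) quot_factor quot_factor_zmod.
HB.instance Definition _ :=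
  GRing.isMonoidMorphism.Build (quot_ring I) (quot_ring J) quot_factor quot_factor_monoid.

End IteratedQuotient.

Lemma ideal_gen_nil (A : comPzRingType) (x : A) : ideal_gen [::] x <-> x = 0.
Proof.
split=> [|->]; last exact: span0.
elim/span_ind: x / => // [x y -> ->|x [a [f []]]] //; exact: addr0.
Qed.

Lemma ideal_gen_rcons (A : comPzRingType) (fs : seq A) f (x : A) :
  ideal_gen (rcons fs f) x <-> exists a, ideal_gen fs (x - a * f).
Proof.
split=> [|[a Ix]].
  elim/span_ind: x / => [|x y [a Ix] [b Iy]|_ [a [h [hs ->]]]].
  - by exists 0; rewrite mul0r subr0; apply: span0.
  - exists (a + b); rewrite mulrDl opprD addrACA; exact: spanD.
  - move: hs; rewrite mem_rcons inE => /predU1P[->|hs].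
      by exists a; rewrite subrr; apply: span0.
    by exists 0; rewrite mul0r subr0; apply: span_mem; exists a, h.
rewrite -[x](subrK (a * f)); apply: spanD.
  elim/span_ind: (x - a * f) / Ix => [|u v|u [b [h [hs ->]]]].
  - exact: span0.
  - exact: spanD.
  - by apply: span_mem; exists b, h; rewrite mem_rcons inE hs orbT.
by apply: span_mem; exists a, f; rewrite mem_rcons inE eqxx.
Qed.

(** * The complete intersection *)

Section CompleteIntersection.
Variables (K : fieldType) (m n : nat).
Notation S := (bigraded_mpoly K m n).
Implicit Type fs : seq S.

Lemma quot_strip_koszul fs (fs_deg : {in fs, forall f, gr_homog (2, 1) f}) :
  (forall i, (i < size fs)%N -> forall x,
     ideal_gen (take i fs) (fs`_i * x) -> ideal_gen (take i fs) x) ->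
  (exists y k, @strip_koszul (quot_ring (homog_ideal fs_deg)) y k) /\
  reg_bounded (quot_ring (homog_ideal fs_deg)).
Proof.
elim/last_ind: fs fs_deg => [|fs f IHfs] fs_deg fs_reg.
  pose I := homog_ideal fs_deg.
  have inj : injective (quot_proj I).
    move=> x y /eqP; rewrite -subr_eq0 -rmorphB => /eqP/quot_proj_eq0/ideal_gen_nil.
    exact: subr0_eq.
  split; last exact: reg_bounded_base (@quot_proj_homog _ _ I) (@quot_proj_lift _ _ I) inj.
  exists (quot_proj I \o tvar K m n), n.
  exact: strip_koszul_base (@quot_proj_homog _ _ I) (@quot_proj_lift _ _ I) inj.
have fs_deg' : {in fs, forall g, gr_homog (2, 1) g}.
  by move=> g gs; apply: fs_deg; rewrite mem_rcons inE gs orbT.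
have [i ifs x|[y [k Hs]] R'b] := IHfs fs_deg'.
  have := fs_reg i; rewrite size_rcons ltnS (ltnW ifs) nth_rcons ifs.
  by rewrite -cats1 takel_cat ?(ltnW ifs) // => /(_ isT x).
have Hf : gr_homog (2, 1) f by apply: fs_deg; rewrite mem_rcons inE eqxx.
pose I := homog_ideal fs_deg'; pose J := homog_ideal fs_deg.
have IJ x : I x -> J x.
  by move=> Ix; apply/ideal_gen_rcons; exists 0; rewrite mul0r subr0.
have f_reg (x : quot_ring I) : quot_proj I f * x = 0 -> x = 0.
  have [z <-] := quot_proj_surj x; rewrite -rmorphM => /quot_proj_eq0 Ifz.
  apply/quot_proj_eq0; have := fs_reg (size fs).
  rewrite size_rcons ltnSn nth_rcons ltnn eqxx -cats1 take_size_cat //.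
  by move=> /(_ isT z); apply.
have psi_homog g (x : quot_ring I) : gr_homog g x -> gr_homog g (quot_factor J x).
  move=> /quot_proj_lift[z Hz <-]; rewrite quot_factor_proj //.
  exact: quot_proj_homog.
have psi_lift g (w : quot_ring J) : gr_homog g w ->
    exists2 x : quot_ring I, gr_homog g x & quot_factor J x = w.
  move=> /quot_proj_lift[z Hz <-]; exists (quot_proj I z).
    exact: quot_proj_homog.
  exact: quot_factor_proj.
have psi_ker (x : quot_ring I) : quot_factor J x = 0 <->
    exists z, x = quot_proj I f * z.
  have [u <-] := quot_proj_surj x; rewrite quot_factor_proj // quot_proj_eq0.
  split=> [/ideal_gen_rcons[a Ia]|[z]].
    exists (quot_proj I a); apply/subr0_eq; rewrite mulrC -rmorphM -rmorphB.
    exact/quot_proj_eq0.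
  have [a <-] := quot_proj_surj z => /eqP.
  rewrite mulrC -rmorphM -subr_eq0 -rmorphB => /eqP/quot_proj_eq0 Ia.
  by apply/ideal_gen_rcons; exists a.
have If := quot_proj_homog I Hf.
split; last exact: (reg_bounded_reduction psi_homog If f_reg psi_lift psi_ker Hs R'b).
exists (quot_factor J \o y), k.
exact: (strip_reduction psi_homog If f_reg psi_lift psi_ker Hs).
Qed.

Section NonZero.
Variables (fs : seq S) (fs_deg : {in fs, forall f, gr_homog (2, 1) f}).

Lemma ideal_gen_supp p : ideal_gen fs p ->
  forall u, p@_u != 0 -> 2 <= (bideg u).1 /\ 1 <= (bideg u).2.
Proof.
elim/span_ind: p / => [|p q Ip Iq|_ [a [f [ff ->]]]] u.
- by rewrite mcoeff0 eqxx.
- by rewrite mcoeffD; have [->|/Ip//] := eqVneq p@_u 0; rewrite add0r => /Iq.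
- rewrite -mcoeff_msupp => /msuppM_le /allpairsP[[v w] [_ wf ->]].
  by rewrite bidegD (fs_deg ff wf) /=; split; rewrite lerDr.
Qed.

(** The ideal only has monomials of bidegree at least (2, 1) in both entries, so anything outside
    that quadrant survives. *)
Lemma quot_proj_neq0 (h : int * int) (p : S) : gr_homog h p -> p != 0 ->
  (h.1 < 2) || (h.2 < 1) -> quot_proj (homog_ideal fs_deg) p <> 0.
Proof.
move=> /bihomogP Hp p0 h21 /quot_proj_eq0/ideal_gen_supp Ip.
case/eqP: p0; apply/mpolyP => u; rewrite mcoeff0; apply/eqP.
apply: contraT => pu; have [h1 h2] := Ip u pu.
by move: h21; rewrite -(Hp u pu) !ltNge h1 h2.
Qed.

Lemma homog_exp (f : S) g i : gr_homog g f -> gr_homog (g *+ i) (f ^+ i).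
Proof.
move=> Hf; elim: i => [|i IHi]; first exact: gr_homog1.
by rewrite exprS mulrS; apply: gr_homogM.
Qed.

Lemma mpolyX_neq0 (u : 'X_{1..m + n}) : 'X_[u] != 0 :> {mpoly K[m + n]}.
Proof.
by apply/eqP => /(congr1 (mcoeff u))/eqP; rewrite mcoeffX eqxx mcoeff0 oner_eq0.
Qed.

End NonZero.
End CompleteIntersection.

Theorem proposition2p2 (K : fieldType) (m n : nat)
    (hm : (1 <= m)%N) (hn : (1 <= n)%N)
    (fs : seq (bigraded_mpoly K m n))
    (fs_deg : {in fs, forall f, gr_homog (2, 1) f})
    (fs_reg : regular_sequence fs) :
  let R := quot_ring (homog_ideal fs_deg) in
  koszul (diag_ring R) /\
  forall a b : int,
    let M := diag_module (shift_module (regular_module R) (a, b)) in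
    has_linear_resolution M /\ reg M = (Num.max a b)%:E.
Proof.
move=> R; have [[y [k Hs]] Rb] := quot_strip_koszul fs_deg (proj1 fs_reg).
split=> [|a b M].
  have kK := strip_reg_residue Hs Rb.
  have A0 j (x : diag_ring R) : j < 0 -> gr_homog j x -> x = 0.
    move=> j0 Hx; apply: val_inj; apply: strip_ge0 Hs _ _ Hx _.
    by rewrite /= j0.
  have K0 j (x : residue_module (diag_ring R)) : j < 0 -> gm_homog j x -> x = 0.
    by move=> j0 [v /(A0 j v j0) -> ->]; apply: raddf0.
  exists 0; split; first exact: generated_in_bottom_degree (kK 0%N) K0.
  have H1 := gr_homog1 (diag_ring R).
  pose q : residue_module (diag_ring R) :=
    qpi (irrelevant_ideal (diag_ring R)) (1 : diag_ring R).
  have Hq : gm_homog 0 q by exists (1 : diag_ring R).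
  apply: (reg_eq kK K0 Hq) => /qpi_eq0 I1.
  have := irr_mul_bottom (M := regular_module (diag_ring R)) A0 H1 I1.
  move=> /(congr1 val); rewrite -[LHS]/(quot_proj (homog_ideal fs_deg) 1).
  apply: (quot_proj_neq0 (h := 0)) => //; last exact: oner_neq0.
  exact: (gr_homog1 (bigraded_mpoly K m n)).
pose d := Num.max a b.
have M0 j (x : M) : j < d -> gm_homog j x -> x = 0.
  rewrite lt_max => jd Hx; apply: val_inj; apply: strip_ge0 Hs _ _ Hx _.
  by move: jd; rewrite /= !subr_lt0.
suff [x Hx x0] : exists2 x : M, gm_homog d x & x <> 0.
  have rM := reg_eq (fun l => Rb l a b) M0 Hx x0; split=> //; exists d.
  by split=> //; apply: generated_in_bottom_degree (Rb 0%N a b) M0.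
(* The witness will be x_1^(d - a) t_1^(d - b). One of the exponents is 0 because d = max(a, b), so
   that its class in [R] is non-zero. *)
suff [p Hp p0] : exists2 p : bigraded_mpoly K m n,
    gr_homog ((d, d) - (a, b)) p & p != 0.
  have Hp' : gm_homog (d, d) (quot_proj (homog_ideal fs_deg) p
      : shift_module (regular_module R) (a, b)).
    exact: quot_proj_homog.
  exists (Sub (quot_proj (homog_ideal fs_deg) p
    : shift_module (regular_module R) (a, b)) (diag_mem_homog Hp')) => //.
  move=> /(congr1 val); apply: (quot_proj_neq0 Hp p0).
  by rewrite /d /=; lia.
have -> : (d, d) - (a, b) =
    (1, 0) *+ `|d - a|%N + (0, 1) *+ `|d - b|%N :> (int * int)%type.
  by rewrite pair10_mulrn pair01_mulrn /d; congr pair; rewrite /=; lia.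
exists ('X_(lshift n (Ordinal hm)) ^+ `|d - a|%N * 'X_(rshift m (Ordinal hn)) ^+ `|d - b|%N).
  apply: gr_homogM; apply: homog_exp.
    by rewrite -(bideg_lshift n (Ordinal hm)); apply: mpolyX_homog.
  by rewrite -(bideg_rshift m (Ordinal hn)); apply: mpolyX_homog.
by rewrite mulf_neq0 // expf_neq0 // mpolyX_neq0.
Qed.
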